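(* Let $D$ be a predilator such that $\overline D(\omega^2)$ is well-founded. Then at least one of the following holds: (i) $\mathsf{RCA}_0\vDash_\omega\text{``$D$ is a dilator''}$; (ii) $D$ has a thread.
   Context: Linear orders have underlying set $\subseteq\mathbb N$. A (coded) predilator is a monotone functor $D$ ($f\le g$ pointwise implies $D(f)\le D(g)$) from the category $\mathsf{Nat}$ of finite orders $n=\{0,\ldots,n-1\}$ with embeddings to the category of linear orders with embeddings, with a natural transformation $\mathrm{supp}:D\Rightarrow[\cdot]^{<\omega}$ to the finite-powerset functor such that for every $f:m\to n$, every $\tau\in D(n)$ with $\mathrm{supp}_n(\tau)\subseteq\mathrm{rng}(f)$ lies in $\mathrm{rng}(D(f))$; it is coded by a subset of $\mathbb N$. For a finite order $a$ let $\mathrm{en}_a:|a|\to a$ be its increasing enumeration and for embeddings $f:a\to b$ of finite orders let $|f|$ satisfy $\mathrm{en}_b\circ|f|=f\circ\mathrm{en}_a$. For a linear order $\alpha$, $\overline D(\alpha)$ is the set of pairs $(\sigma,a)$ with $a\subseteq\alpha$ finite, $\sigma\in D(|a|)$, $\mathrm{supp}_{|a|}(\sigma)=\{0,\ldots,|a|-1\}$, ordered by $(\sigma,a)\le(\tau,b)$ iff $D(|\iota_a|)(\sigma)\le D(|\iota_b|)(\tau)$ (inclusions into $a\cup b$); for an embedding $f:\alpha\to\beta$, $\overline D(f)(\sigma,a)=(\sigma,f[a])$. $D$ is a dilator if $\overline D(\alpha)$ is well-founded for all well orders $\alpha$. $\omega^2$ is the order of pairs $\omega\cdot m+n$ ($m,n\in\mathbb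 N$) compared lexicographically with $m$ first. $\mathsf T\vDash_\omega\varphi(X_1,\ldots,X_n)$ means there is $Y\subseteq\mathbb N$ with $\mathcal M\vDash\varphi(X_1,\ldots,X_n)$ for every $\omega$-model $\mathcal M\vDash\mathsf T$ containing $X_1,\ldots,X_n,Y$. For a linear order $L=(\mathbb N,\le_L)$, let $\pi^L_n$ be the permutation of $\{0,\ldots,n-1\}$ with $\pi^L_n(i)\le\pi^L_n(j)\Leftrightarrow i\le_Lj$, and $\sigma^L_i=\sigma(\pi^L_{l(\sigma)}(i))$ for a finite sequence $\sigma$ of length $l(\sigma)$. $D_L(\alpha)$ is the set of strictly increasing finite sequences in $\alpha$ with $\sigma<\tau$ iff either some $j<\min(l(\sigma),l(\tau))$ has $\sigma^L_j<\tau^L_j$ and $\sigma^L_i=\tau^L_i$ for $i<j$, or $l(\sigma)<l(\tau)$ and $\sigma^L_i=\tau^L_i$ for $i<l(\sigma)$; $D_L(f)$ acts entrywise. For a linear order $\alpha$, $\omega\cdot(1+\alpha)$ has elements $\omega\cdot0+n$ and $\omega\cdot(1+x)+n$ ($x\in\alpha$, $n\in\mathbb N$), ordered lexicographically with $0<1+x<1+y$ for $x<y$; an embedding $f$ induces $\omega\cdot(1+f)$ fixing $\omega\cdot0+n$ and sending $\omega\cdot(1+x)+n$ to $\omega\cdot(1+f(x))+n$. A linear order $L=(\mathbb N,\le_L)$ is a thread of $D$ if there is a family of order embeddings $\eta_\alpha:D_L(\alpha)\to\overline D(\omega\cdot(1+\alpha))$, $\alpha$ ranging over linear orders, natural in the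 sense that $\eta_\beta\circ D_L(f)=\overline D(\omega\cdot(1+f))\circ\eta_\alpha$ for all embeddings $f:\alpha\to\beta$. *)

(* Defs.v *)
(* MathComp with finmap and the classical sets of MathComp-Analysis. *)
From mathcomp Require Import classical_sets.
From mathcomp Require Import all_boot finmap.

Set Implicit Arguments.
Unset Strict Implicit.
Unset Printing Implicit Defensive.

Local Open Scope nat_scope.

(** * Linear orders *)

(* Orders are given by raw data; only the restriction of [ole] to [odom]
   is meaningful.  Linear orders in the narrow sense are the [A : ord nat]
   with [linear_order A]; other carriers occur only for derived orders such
   as omega^2 and the values of the extended predilators. *)
Record ord (T : Type) := Ord { odom : pred T; ole : rel T }.

Definition linear_order (T : Type) (A : ord T) : Prop :=
  [/\ {in odom A, reflexive (ole A)},
      {in odom A &, antisymmetric (ole A)},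
      {in odom A & &, transitive (ole A)} &
      {in odom A &, total (ole A)}].

Definition olt (T : eqType) (A : ord T) : rel T :=
  fun x y => [&& x \in odom A, y \in odom A, x != y & ole A x y].

Definition order_embedding (T U : Type) (A : ord T) (B : ord U)
    (f : T -> U) : Prop :=
  {in odom A, forall x, f x \in odom B} /\
  {in odom A &, {mono f : x y / ole A x y >-> ole B x y}}.

Definition well_founded_order (T : eqType) (A : ord T) : Prop :=
  well_founded (fun x y => olt A x y).

Definition omega_times (T : eqType) (A : ord T) : ord (T * nat)%type :=
  Ord [pred p | p.1 \in odom A]
      (fun p q => olt A p.1 q.1 || (p.1 == q.1) && (p.2 <= q.2)).

Definition omega : ord nat := Ord predT leq.

Definition omega_squared : ord (nat * nat)%type := omega_times omega.

(* [None] is the new least element 0, and [Some x] stands for 1 + x. *)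
Definition one_plus (T : Type) (A : ord T) : ord (option T) :=
  Ord [pred o | if o is Some x then x \in odom A else true]
      (fun o o' => match o, o' with
                   | None, _ => true
                   | Some _, None => false
                   | Some x, Some y => ole A x y
                   end).

Definition omega_one_plus (T : eqType) (A : ord T) :
  ord (option T * nat)%type := omega_times (one_plus A).

Definition omega_one_plus_map (T U : Type) (f : T -> U)
  (p : option T * nat) : option U * nat := (omap f p.1, p.2).

(** * Predilators *)

Definition increasing m n (f : {ffun 'I_m -> 'I_n}) : Prop :=
  forall i j : 'I_m, i < j -> f i < f j.

(* [pd_mor f] is relevant only for increasing [f] and on [odom (pd_ob m)],
   and [pd_supp] only on [odom (pd_ob n)]. *)
Record predilator := Predilator {
  pd_ob : nat -> ord nat;
  pd_mor : forall m n, {ffun 'I_m -> 'I_n} -> nat -> nat;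
  pd_supp : forall n, nat -> {set 'I_n};
  pd_linear : forall n, linear_order (pd_ob n);
  pd_embedding : forall m n (f : {ffun 'I_m -> 'I_n}), increasing f ->
    order_embedding (pd_ob m) (pd_ob n) (pd_mor f);
  pd_id : forall n s, s \in odom (pd_ob n) ->
    pd_mor [ffun i : 'I_n => i] s = s;
  pd_comp : forall k m n (f : {ffun 'I_k -> 'I_m}) (g : {ffun 'I_m -> 'I_n}) s,
    increasing f -> increasing g -> s \in odom (pd_ob k) ->
    pd_mor [ffun i => g (f i)] s = pd_mor g (pd_mor f s);
  pd_monotone : forall m n (f g : {ffun 'I_m -> 'I_n}) s,
    increasing f -> increasing g -> (forall i, f i <= g i) ->
    s \in odom (pd_ob m) -> ole (pd_ob n) (pd_mor f s) (pd_mor g s);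
  pd_supp_natural : forall m n (f : {ffun 'I_m -> 'I_n}) s,
    increasing f -> s \in odom (pd_ob m) ->
    pd_supp n (pd_mor f s) = f @: pd_supp m s;
  pd_supp_range : forall m n (f : {ffun 'I_m -> 'I_n}) t,
    increasing f -> t \in odom (pd_ob n) ->
    pd_supp n t \subset f @: [set: 'I_m] ->
    exists2 s, s \in odom (pd_ob m) & pd_mor f s = t
}.

Section Extension.
Variables (T : choiceType) (A : ord T).
Implicit Types a b : {fset T}.

Lemma enum_inc_size a : size (sort (ole A) a) == #|` a|.
Proof. by rewrite size_sort. Qed.

Definition enum_inc a : #|` a|.-tuple T := Tuple (enum_inc_size a).

Lemma incl_shape_subproof a b (sab : (a `<=` b)%fset) (i : 'I_#|` a|) :
  index (tnth (enum_inc a) i) (enum_inc b) < #|` b|.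
Proof.
have xa : tnth (enum_inc a) i \in a by rewrite -(mem_sort (ole A)) mem_tnth.
by rewrite -[X in _ < X](size_tuple (enum_inc b)) index_mem mem_sort
  (fsubsetP sab).
Qed.

(* The morphism |iota| of Nat induced by the inclusion iota of a into b. *)
Definition incl_shape a b (sab : (a `<=` b)%fset) :
  {ffun 'I_#|` a| -> 'I_#|` b|} :=
  [ffun i => Ordinal (incl_shape_subproof sab i)].

Definition Dbar (D : predilator) : ord (nat * {fset T})%type :=
  Ord [pred p : nat * {fset T} |
        [&& all (odom A) (enum_fset p.2), p.1 \in odom (pd_ob D #|` p.2|)
          & pd_supp D #|` p.2| p.1 == [set: 'I_#|` p.2|]]]
      (fun p q => ole (pd_ob D #|` (p.2 `|` q.2)%fset|)
                    (pd_mor D (incl_shape (fsubsetUl p.2 q.2)) p.1)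
                    (pd_mor D (incl_shape (fsubsetUr p.2 q.2)) q.1)).

End Extension.

Definition Dbar_map (T U : choiceType) (f : T -> U)
  (p : nat * {fset T}) : nat * {fset U} := (p.1, [fset f x | x in p.2]%fset).

(** * Second-order arithmetic and its omega-models *)

(* Two-sorted first-order syntax with de Bruijn indices, one family for
   number variables and one for set variables. *)
Inductive term :=
  | Var of nat | Zero | One | Plus of term & term | Times of term & term.

Inductive formula :=
  | Eq of term & term
  | Lt of term & term
  | In of term & nat
  | Not of formula
  | And of formula & formula
  | Or of formula & formula
  | Imp of formula & formula
  | All of formula
  | Ex of formula
  | AllSet of formula
  | ExSet of formula.

Definition Iff p q := And (Imp p q) (Imp q p).

Definition scons (X : Type) (x : X) (e : nat -> X) (n : nat) : X :=
  if n is n'.+1 then e n' else x.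

Fixpoint tsubst (s : nat -> term) (t : term) : term :=
  match t with
  | Var n => s n
  | Zero => Zero
  | One => One
  | Plus t u => Plus (tsubst s t) (tsubst s u)
  | Times t u => Times (tsubst s t) (tsubst s u)
  end.

Definition tshift : term -> term := tsubst (fun n => Var n.+1).

Definition up (s : nat -> term) : nat -> term :=
  scons (Var 0) (fun n => tshift (s n)).

Fixpoint fsubst (s : nat -> term) (p : formula) : formula :=
  match p with
  | Eq t u => Eq (tsubst s t) (tsubst s u)
  | Lt t u => Lt (tsubst s t) (tsubst s u)
  | In t X => In (tsubst s t) X
  | Not p => Not (fsubst s p)
  | And p q => And (fsubst s p) (fsubst s q)
  | Or p q => Or (fsubst s p) (fsubst s q)
  | Imp p q => Imp (fsubst s p) (fsubst s q)
  | All p => All (fsubst (up s) p)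
  | Ex p => Ex (fsubst (up s) p)
  | AllSet p => AllSet (fsubst s p)
  | ExSet p => ExSet (fsubst s p)
  end.

Fixpoint srename (r : nat -> nat) (p : formula) : formula :=
  match p with
  | Eq t u => Eq t u
  | Lt t u => Lt t u
  | In t X => In t (r X)
  | Not p => Not (srename r p)
  | And p q => And (srename r p) (srename r q)
  | Or p q => Or (srename r p) (srename r q)
  | Imp p q => Imp (srename r p) (srename r q)
  | All p => All (srename r p)
  | Ex p => Ex (srename r p)
  | AllSet p => AllSet (srename (scons 0 (fun n => (r n).+1)) p)
  | ExSet p => ExSet (srename (scons 0 (fun n => (r n).+1)) p)
  end.

Inductive bounded : formula -> Prop :=
  | bounded_Eq t u : bounded (Eq t u)
  | bounded_Lt t u : bounded (Lt t u)
  | bounded_In t X : bounded (In t X)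
  | bounded_Not p : bounded p -> bounded (Not p)
  | bounded_And p q : bounded p -> bounded q -> bounded (And p q)
  | bounded_Or p q : bounded p -> bounded q -> bounded (Or p q)
  | bounded_Imp p q : bounded p -> bounded q -> bounded (Imp p q)
  | bounded_All t p : bounded p -> bounded (All (Imp (Lt (Var 0) (tshift t)) p))
  | bounded_Ex t p : bounded p -> bounded (Ex (And (Lt (Var 0) (tshift t)) p)).

Definition Sigma01 (p : formula) : Prop := exists2 q, bounded q & p = Ex q.
Definition Pi01 (p : formula) : Prop := exists2 q, bounded q & p = All q.

Definition subst_zero (p : formula) : formula := fsubst (scons Zero Var) p.

(* p(n+1), where n is still the number variable of index 0 *)
Definition subst_succ (p : formula) : formula :=
  fsubst (scons (Plus (Var 0) One) (fun n => Var n.+1)) p.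

Inductive RCA0 : formula -> Prop :=
  | ax_succ_neq0 : RCA0 (Not (Eq (Plus (Var 0) One) Zero))
  | ax_succ_inj :
      RCA0 (Imp (Eq (Plus (Var 0) One) (Plus (Var 1) One)) (Eq (Var 0) (Var 1)))
  | ax_add0 : RCA0 (Eq (Plus (Var 0) Zero) (Var 0))
  | ax_addS :
      RCA0 (Eq (Plus (Var 0) (Plus (Var 1) One)) (Plus (Plus (Var 0) (Var 1)) One))
  | ax_mul0 : RCA0 (Eq (Times (Var 0) Zero) Zero)
  | ax_mulS :
      RCA0 (Eq (Times (Var 0) (Plus (Var 1) One))
               (Plus (Times (Var 0) (Var 1)) (Var 0)))
  | ax_lt0 : RCA0 (Not (Lt (Var 0) Zero))
  | ax_ltS :
      RCA0 (Iff (Lt (Var 0) (Plus (Var 1) One))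
                (Or (Lt (Var 0) (Var 1)) (Eq (Var 0) (Var 1))))
  | ax_induction p : Sigma01 p ->
      RCA0 (Imp (And (subst_zero p) (All (Imp p (subst_succ p)))) (All p))
  | ax_comprehension p q : Sigma01 p -> Pi01 q ->
      RCA0 (Imp (All (Iff p q))
                (ExSet (All (Iff (In (Var 0) 0) (srename succn p))))).

Fixpoint teval (e : nat -> nat) (t : term) : nat :=
  match t with
  | Var n => e n
  | Zero => 0
  | One => 1
  | Plus t u => teval e t + teval e u
  | Times t u => teval e t * teval e u
  end.

(* An omega-model is given by the collection M over which the set variables
   range; numbers and arithmetic are standard. *)
Fixpoint sat (M : set (set nat)) (e : nat -> nat) (E : nat -> set nat)
    (p : formula) : Prop :=
  match p with
  | Eq t u => teval e t = teval e u
  | Lt t u => teval e t < teval e u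
  | In t X => E X (teval e t)
  | Not p => ~ sat M e E p
  | And p q => sat M e E p /\ sat M e E q
  | Or p q => sat M e E p \/ sat M e E q
  | Imp p q => sat M e E p -> sat M e E q
  | All p => forall n, sat M (scons n e) E p
  | Ex p => exists n, sat M (scons n e) E p
  | AllSet p => forall X, M X -> sat M e (scons X E) p
  | ExSet p => exists2 X, M X & sat M e (scons X E) p
  end.

Definition omega_model (th : formula -> Prop) (M : set (set nat)) : Prop :=
  forall p, th p ->
  forall e E, (forall i, M (E i)) -> sat M e E p.

(* [phi M] is the truth of a fixed statement about the parameters [X i] in
   the omega-model M, that is, with set quantifiers relativised to M. *)
Definition omega_entails (th : formula -> Prop) (n : nat)
    (X : 'I_n -> set nat) (phi : set (set nat) -> Prop) : Prop :=
  exists Y : set nat, forall M : set (set nat),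
    omega_model th M -> (forall i, M (X i)) -> M Y -> phi M.

(** * Coding by sets of numbers *)

(* the pairing function customary in second-order arithmetic *)
Definition npair (i j : nat) : nat := (i + j) ^ 2 + i.

Definition graph_code (f : nat -> nat) : set nat :=
  [set k | exists n, k = npair n (f n)]%classic.

Definition ord_code (A : ord nat) : set nat :=
  [set k | exists x y, [/\ x \in odom A, y \in odom A, ole A x y
                         & k = npair x y]]%classic.

Definition Dbar_elt_code (p : nat * {fset nat}) : nat :=
  npair p.1 (CodeSeq.code (sort leq p.2)).

(* The three parts represent the orders D(n), the maps D(f) and the supports;
   f : m -> n is coded by n and the sequence of its m values. *)
Definition predilator_code (D : predilator) : set nat :=
  ([set k | exists n s t,
      [/\ s \in odom (pd_ob D n), t \in odom (pd_ob D n), ole (pd_ob D n) s t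
        & k = npair 0 (npair n (npair s t))]] `|`
   [set k | exists m n (f : {ffun 'I_m -> 'I_n}) s,
      [/\ increasing f, s \in odom (pd_ob D m)
        & k = npair 1 (npair n
                (npair (CodeSeq.code [seq val (f i) | i <- enum 'I_m])
                       (npair s (pd_mor D f s))))]] `|`
   [set k | exists n s, s \in odom (pd_ob D n) /\
      k = npair 2 (npair n
            (npair s (CodeSeq.code [seq val i | i <- enum (pd_supp D n s)])))]
  )%classic.

(** * Dilators in an omega-model *)

(* M contains no infinite descending sequence of A, whose elements are coded
   by numbers via [c]. *)
Definition well_founded_in (M : set (set nat)) (T : eqType) (c : T -> nat)
    (A : ord T) : Prop :=
  ~ exists f : nat -> T,
      (forall n, olt A (f n.+1) (f n)) /\ M (graph_code (fun n => c (f n))).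

Definition dilator_in (D : predilator) (M : set (set nat)) : Prop :=
  forall A : ord nat,
    linear_order A -> M (ord_code A) -> well_founded_in M id A ->
    well_founded_in M Dbar_elt_code (Dbar A D).

Definition RCA0_entails_dilator (D : predilator) : Prop :=
  omega_entails RCA0 (fun _ : 'I_1 => predilator_code D) (dilator_in D).

(** * Threads *)

(* pi^L_n(i) is the position of i when 0, ..., n-1 are listed in L-increasing
   order. *)
Definition perm_of (L : rel nat) (n i : nat) : nat :=
  index i (sort L (iota 0 n)).

(* sigma^L_i, used only for i < size s *)
Definition perm_entry (L : rel nat) (s : seq nat) (i : nat) : nat :=
  nth 0 s (perm_of L (size s) i).

Definition D_lt (L : rel nat) (A : ord nat) (s t : seq nat) : bool :=
  [exists j : 'I_(minn (size s) (size t)),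
     olt A (perm_entry L s j) (perm_entry L t j) &&
     [forall i : 'I_j, perm_entry L s i == perm_entry L t i]]
  || (size s < size t) &&
     [forall i : 'I_(size s), perm_entry L s i == perm_entry L t i].

Definition D_order (L : rel nat) (A : ord nat) : ord (seq nat) :=
  Ord [pred s | all (odom A) s && sorted (olt A) s]
      (fun s t => (s == t) || D_lt L A s t).

Definition thread (D : predilator) (L : rel nat) : Prop :=
  linear_order (Ord predT L) /\
  exists eta : ord nat -> seq nat -> nat * {fset (option nat * nat)},
    (forall A, linear_order A ->
       order_embedding (D_order L A) (Dbar (omega_one_plus A) D) (eta A)) /\
    (forall A B (f : nat -> nat), linear_order A -> linear_order B ->
       order_embedding A B f ->
       forall s, s \in odom (D_order L A) ->
         eta B (map f s) = Dbar_map (omega_one_plus_map f) (eta A s)).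

(* Main.v *)
Require Import Defs.
From mathcomp Require Import boolp classical_sets.
From mathcomp Require Import all_boot finmap zify.

(* A term of [D] depends on its arguments lexicographically, with respect to a
   priority order on the argument positions that belongs to the term; on two
   terms that share their first [j] priority arguments, the [j]-th one either
   decides the comparison or is irrelevant for it.

   Suppose that (i) fails.  Call a set of runs (pairs of a linear order A and a
   descending sequence in D(A)) negligible if some oracle Y ensures that no
   omega-model containing Y and a run from the set believes that A is
   well-founded.  Negligible sets form a sigma-ideal that does not contain the
   set of all runs.  If an element of A that is computed continuously along the
   run can always be decreased later on, then a suitable oracle finds a
   descending sequence in A; so after shrinking a non-negligible set of runs,
   such an element is minimal.  On the other hand, irrelevant arguments can be
   moved into omega^2, so that by well-foundedness of D(omega^2) a descending
   run must at each stage j end up with terms linked through their j-th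
   priority argument.  Alternating these two steps stabilizes all priorities one
   after another.  This yields a sequence of terms, linked at each stage, whose
   common priority pattern is an order L on the natural numbers.  The n-th term
   with its first n priority arguments replaced by the entries of a sequence of
   length n is the value of the thread; its remaining arguments are accommodated
   in the gaps of omega * (1 + alpha). *)

Set Implicit Arguments.
Unset Strict Implicit.
Unset Printing Implicit Defensive.

Local Open Scope nat_scope.

(** * Increasing tuples of arguments and the values of terms at them *)

Definition incr k N (u : nat -> nat) : Prop :=
  (forall i j, i < j -> j < k -> u i < u j) /\ (forall i, i < k -> u i <= N).

Lemma incr_leE k N u i j : incr k N u -> i < k -> j < k ->
  (u i <= u j) = (i <= j).
Proof.
move=> [h _] ik jk; case: (ltngtP i j) => [ij|ji|->]; last by rewrite leqnn.
- by rewrite ltnW // h.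
- by apply/negbTE; rewrite -ltnNge h.
Qed.

Lemma incr_ltE k N u i j : incr k N u -> i < k -> j < k ->
  (u i < u j) = (i < j).
Proof. by move=> h ik jk; rewrite !ltnNge (incr_leE h). Qed.

Lemma incr_comp k N N' u e : incr k N u -> incr N.+1 N' e ->
  incr k N' (fun i => e (u i)).
Proof.
move=> [h b] [h' b']; split=> [i j ij jk|i ik].
  by apply: h' (h _ _ ij jk) _; rewrite ltnS b.
by apply: b'; rewrite ltnS b.
Qed.

(** Embeddings of finite orders are handled as plain functions on [nat] under [incr], which avoids
    dependent types; [ev] turns them back into morphisms. *)
Definition ev N k (u : nat -> nat) : {ffun 'I_k -> 'I_N.+1} :=
  [ffun i : 'I_k => inord (u i)].

Lemma ev_val N k u (i : 'I_k) : incr k N u -> ev N k u i = u i :> nat.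
Proof. by move=> [_ b]; rewrite ffunE inordK // ltnS b. Qed.

Lemma ev_increasing N k u : incr k N u -> increasing (ev N k u).
Proof.
by move=> h i j ij; rewrite !(ev_val _ h) (incr_ltE h).
Qed.

Lemma eq_ev N k u v : (forall i, i < k -> u i = v i) -> ev N k u = ev N k v.
Proof. by move=> h; apply/ffunP=> i; rewrite !ffunE h. Qed.

(* Ranks of points among the points of [X] are scaled so that the relative
   position of the points of [X] alone determines their images, while [z]
   prescribes the place of the other points in the gaps of [X]. *)
Definition rank (X : seq nat) (b : nat) := count (fun x => x <= b) X.

Definition blow M (X : seq nat) (z : nat -> nat) b :=
  if b \in X then (4 * rank X b) * M else (4 * rank X b + z b) * M + b.

Lemma rank_le X b c : b <= c -> rank X b <= rank X c.
Proof. by move=> bc; apply: sub_count => x /= /leq_trans; apply. Qed.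

Lemma rank_lt X b c : b < c -> c \in X -> rank X b < rank X c.
Proof.
move=> bc; elim: X => // x X IH; rewrite in_cons /rank /= -/(rank X b) -/(rank X c).
have rle := rank_le X (ltnW bc).
case/orP=> [/eqP <-|/IH]; first by rewrite leqnn [c <= b]leqNgt bc; lia.
by case: (leqP x b) => xb; rewrite ?(leq_trans xb (ltnW bc)); lia.
Qed.

Lemma rank_size X b : rank X b <= size X.
Proof. exact: count_size. Qed.

(** Block number [4 * r] is reserved for the point of [X] of rank [r], and the three blocks after it
    for the points in the next gap, as [z] prescribes. Blocks have length [M > N], so that adding
    [b] keeps the order inside a block without leaving it. *)
Lemma incr_blow M N (X : seq nat) z : N < M ->
  (forall b, 1 <= z b <= 3) -> (forall b c, b <= c -> z b <= z c) ->
  incr N.+1 ((4 * size X + 4) * M) (blow M X z).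
Proof.
move=> NM z13 zle; split=> [b c bc cN|b bN].
- have bM : b < M by lia.
  have rbc := rank_le X (ltnW bc).
  have lo : (4 * rank X b + z b) * M + b < (4 * rank X b + 4) * M.
    have : (4 * rank X b + z b).+1 * M <= (4 * rank X b + 4) * M.
      by rewrite leq_mul2r; have := z13 b; lia.
    by rewrite mulSn; lia.
  rewrite /blow; case: ifPn => bX; case: ifPn => cX.
  + by rewrite ltn_pmul2r; have := rank_lt bc cX; lia.
  + have : (4 * rank X b) * M <= (4 * rank X c + z c) * M.
      by rewrite leq_mul2r; lia.
    by lia.
  + apply: leq_trans lo _; rewrite leq_mul2r.
    by have := rank_lt bc cX; lia.
  + have : (4 * rank X b + z b) * M <= (4 * rank X c + z c) * M.
      by rewrite leq_mul2r; have := zle _ _ (ltnW bc); lia.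
    by lia.
- have bM : b < M by lia.
  have rs := rank_size X b.
  have le4 x : x <= 3 -> (4 * rank X b + x) * M + b <= (4 * size X + 4) * M.
    move=> x3; have : (4 * rank X b + x).+1 * M <= (4 * size X + 4) * M.
      apply: leq_mul => //; lia.
    by rewrite mulSn; lia.
  rewrite /blow; case: ifPn => _; last by apply: le4; have := z13 b; lia.
  by have := le4 0 isT; rewrite addn0; lia.
Qed.

Lemma rank_map (I : eqType) (s : seq I) (x y : I -> nat) (b c : nat) :
  {in s, forall i, (x i <= b) = (y i <= c)} ->
  rank (map x s) b = rank (map y s) c.
Proof. by move=> h; rewrite /rank !count_map; apply: eq_in_count. Qed.

Section Points.
Variable D : predilator.

(* A term is an element [s] of [D k] with full support; its value at the
   arguments [u 0 < ... < u k.-1 <= N] is the point [pt N k s u] of [D N.+1]. *)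
Definition trace k s : Prop :=
  s \in odom (pd_ob D k) /\ pd_supp D k s = [set: 'I_k].

Definition pt N k s u : nat := pd_mor D (ev N k u) s.

Definition dle N := ole (pd_ob D N.+1).
Definition dlt N x y := ~~ dle N y x.

Definition din N x := x \in odom (pd_ob D N.+1).

Lemma pt_in N k s u : trace k s -> incr k N u -> din N (pt N k s u).
Proof. by move=> [sD _] /ev_increasing /(@pd_embedding D _ _ _) [h _]; apply: h. Qed.

Lemma dle_refl N x : din N x -> dle N x x.
Proof. by have [h _ _ _] := pd_linear D N.+1; apply: h. Qed.

Lemma dle_total N x y : din N x -> din N y -> dle N x y || dle N y x.
Proof. by have [_ _ _ h] := pd_linear D N.+1; apply: h. Qed.

Lemma dle_trans N y x z : din N x -> din N y -> din N z ->
  dle N x y -> dle N y z -> dle N x z.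
Proof. by have [_ _ h _] := pd_linear D N.+1 => ? ? ?; apply: h. Qed.

Lemma dle_anti N x y : din N x -> din N y -> dle N x y -> dle N y x -> x = y.
Proof.
by have [_ h _ _] := pd_linear D N.+1 => ? ? xy yx; apply: h => //; apply/andP.
Qed.

Lemma dltW N x y : din N x -> din N y -> dlt N x y -> dle N x y.
Proof. by move=> xN yN; rewrite /dlt; have /orP[->|->] := dle_total xN yN. Qed.

Lemma dlt_le_trans N y x z : din N x -> din N y -> din N z ->
  dlt N x y -> dle N y z -> dlt N x z.
Proof. by move=> xN yN zN xy yz; apply: contra xy; apply: dle_trans. Qed.

Lemma dle_lt_trans N y x z : din N x -> din N y -> din N z ->
  dle N x y -> dlt N y z -> dlt N x z.
Proof. by move=> xN yN zN xy yz; apply: contra yz => zx; apply: dle_trans zx xy. Qed.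

Lemma dlt_neq N x y : din N x -> din N y -> dle N x y -> x <> y -> dlt N x y.
Proof. by move=> xN yN xy ne; apply/negP=> yx; apply: ne; apply: dle_anti yx. Qed.

Lemma eq_pt N k s u v : (forall i, i < k -> u i = v i) ->
  pt N k s u = pt N k s v.
Proof. by move=> h; rewrite /pt (eq_ev _ h). Qed.

Lemma pt_comp N N' k s u e : trace k s -> incr k N u -> incr N.+1 N' e ->
  pt N' k s (fun i => e (u i)) = pd_mor D (ev N' N.+1 e) (pt N k s u).
Proof.
move=> [sD _] hu he; rewrite /pt -pd_comp //; try exact: ev_increasing.
congr (pd_mor D _ _); apply/ffunP=> i; apply: val_inj.
by rewrite /= (ev_val _ (incr_comp hu he)) ffunE (ev_val _ he) (ev_val _ hu).
Qed.

Lemma dle_comp N N' k l s t u v e : trace k s -> trace l t ->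
  incr k N u -> incr l N v -> incr N.+1 N' e ->
  dle N' (pt N' k s (fun i => e (u i))) (pt N' l t (fun i => e (v i))) =
  dle N (pt N k s u) (pt N l t v).
Proof.
move=> ks lt hu hv he; rewrite !(pt_comp _ _ he) //.
have [_ h] := @pd_embedding D _ _ _ (ev_increasing he).
by rewrite /dle h //; apply: pt_in.
Qed.

Lemma pt_inj N k l s t u v : trace k s -> trace l t -> incr k N u -> incr l N v ->
  pt N k s u = pt N l t v ->
  [/\ k = l, s = t & forall i, i < k -> u i = v i].
Proof.
move=> [sD ss] [tD st] hu hv e.
have iu := ev_increasing hu; have iv := ev_increasing hv.
have := congr1 (pd_supp D N.+1) e.
rewrite /pt !pd_supp_natural // ss st => im.
have inj m (f : {ffun 'I_m -> 'I_N.+1}) : increasing f -> injective f.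
  move=> hf i j fij; apply: val_inj; case: (ltngtP i j) => // ij.
    by have := hf _ _ ij; rewrite fij ltnn.
  by have := hf _ _ ij; rewrite fij ltnn.
have kl : k = l.
  by rewrite -(card_ord k) -(card_ord l) -!cardsT -(card_imset _ (inj _ _ iu))
    im (card_imset _ (inj _ _ iv)).
subst l.
have sm (f : {ffun 'I_k -> 'I_N.+1}) : increasing f ->
    sorted ltn [seq val (f i) | i <- enum 'I_k].
  move=> hf; rewrite sorted_map.
  apply: (sub_sorted (e := relpre val ltn)) => [i j /= ij|]; first exact: hf.
  by rewrite -sorted_map val_enum_ord iota_ltn_sorted.
have uv : [seq val (ev N k u i) | i <- enum 'I_k] =
          [seq val (ev N k v i) | i <- enum 'I_k].
  apply: (irr_sorted_eq ltn_trans ltnn); rewrite ?sm // => x.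
  have key (f : {ffun 'I_k -> 'I_N.+1}) :
    (x \in [seq val (f i) | i <- enum 'I_k]) = (x \in map val (enum (f @: setT))).
    apply/mapP/mapP => [[i _ ->]|[y]].
      by exists (f i) => //; rewrite mem_enum imset_f.
    by rewrite mem_enum => /imsetP [i _ ->] ->; exists i; rewrite ?mem_enum.
  by rewrite !key im.
have uvE : ev N k u = ev N k v.
  apply/ffunP=> i; apply: val_inj.
  have iE f : nth 0 [seq val (f i : 'I_N.+1) | i <- enum 'I_k] i = f i.
    by rewrite (nth_map (i : 'I_k)) ?size_enum_ord ?ltn_ord // nth_ord_enum.
  by rewrite /= -!iE uv.
split=> // [|i ik].
  have [_ h] := @pd_embedding D _ _ _ iv.
  have [r a _ _] := pd_linear D k.
  move: e; rewrite /pt uvE => e.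
  apply: a => //; rewrite -!h // e andbb.
  by have [r' _ _ _] := pd_linear D N.+1; apply: r'; have := pt_in (conj tD st) hv.
by rewrite -(ev_val (Ordinal ik) hu) -(ev_val (Ordinal ik) hv) uvE.
Qed.

Lemma pt_mono N k s u v : trace k s -> incr k N u -> incr k N v ->
  (forall i, i < k -> u i <= v i) -> dle N (pt N k s u) (pt N k s v).
Proof.
move=> [sD _] hu hv uv; apply: pd_monotone => //; try exact: ev_increasing.
by move=> i; rewrite !ev_val ?uv.
Qed.

(* The order of two points depends only on the relative position of their
   arguments: blow both configurations up over all of their own points. *)
Lemma dle_type N N' k l s t u v u' v' : trace k s -> trace l t ->
  incr k N u -> incr l N v -> incr k N' u' -> incr l N' v' ->
  (forall i j, i < k -> j < l -> (u i <= v j) = (u' i <= v' j)) ->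
  (forall i j, i < k -> j < l -> (v j <= u i) = (v' j <= u' i)) ->
  dle N (pt N k s u) (pt N l t v) = dle N' (pt N' k s u') (pt N' l t v').
Proof.
move=> ks lt hu hv hu' hv' uv vu.
pose X (f g : nat -> nat) := map f (iota 0 k) ++ map g (iota 0 l).
pose M := (N + N').+1.
pose e f g := blow M (X f g) (fun => 1).
have Xs f g : size (X f g) = k + l by rewrite size_cat !size_map !size_iota.
have he : incr N.+1 ((4 * (k + l) + 4) * M) (e u v).
  by rewrite -(Xs u v); apply: incr_blow; rewrite ?/M //; lia.
have he' : incr N'.+1 ((4 * (k + l) + 4) * M) (e u' v').
  by rewrite -(Xs u' v'); apply: incr_blow; rewrite ?/M //; lia.
rewrite -(dle_comp ks lt hu hv he) -(dle_comp ks lt hu' hv' he').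
have inX1 f g i : i < k -> f i \in X f g.
  by move=> ik; rewrite mem_cat map_f ?mem_iota.
have inX2 f g i : i < l -> g i \in X f g.
  by move=> ik; rewrite mem_cat orbC map_f ?mem_iota.
have rkE b b' : {in iota 0 k, forall i, (u i <= b) = (u' i <= b')} ->
    {in iota 0 l, forall i, (v i <= b) = (v' i <= b')} ->
    rank (X u v) b = rank (X u' v') b'.
  by move=> h h'; rewrite /X /rank !count_cat; congr (_ + _); apply: rank_map.
congr (dle _ _ _).
  apply: eq_pt => i ik; rewrite /e /blow !inX1 // (rkE _ (u' i)) // => j;
  rewrite mem_iota => /andP[_ jk]; first by rewrite (incr_leE hu) ?(incr_leE hu').
  exact: vu.
apply: eq_pt => i ik; rewrite /e /blow !inX2 // (rkE _ (v' i)) // => j;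
  rewrite mem_iota => /andP[_ jk]; last by rewrite (incr_leE hv) ?(incr_leE hv').
exact: uv.
Qed.

End Points.

(** * Priorities of arguments *)

Section Priorities.
Variable D : predilator.

Definition beats k s i l : Prop := forall N u v, incr k N u -> incr k N v ->
  (forall x, x < k -> x != i -> x != l -> u x = v x) ->
  u i < v i -> v l < u l -> dlt D N (pt D N k s u) (pt D N k s v).

(** All exchanges of [i] against [l] look alike as configurations, so that by [dle_type] a single
    instance decides how every one of them affects the value. *)
Lemma exchange_pattern k N u v i l : incr k N u -> incr k N v -> i < k -> l < k ->
  (forall x, x < k -> x != i -> x != l -> u x = v x) ->
  u i < v i -> v l < u l ->
  forall a b, a < k -> b < k -> (v a <= u b) = (a < b) || (a == b) && (a != i).
Proof.
move=> [hu _] [hv _] ik lk uv ui vl a b ak bk.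
have up x : x < k -> x != l -> u x <= v x.
  by move=> xk xl; case: (eqVneq x i) => [->|xi]; [exact: ltnW|rewrite uv].
have dn x : x < k -> x != i -> v x <= u x.
  by move=> xk xi; case: (eqVneq x l) => [->|xl]; [exact: ltnW|rewrite uv].
case: (ltngtP a b) => [ab|ba|<-] /=.
- case: (eqVneq a i) => [ai|/(dn _ ak)]; last by have := hu _ _ ab bk; lia.
  have bi : b != i by lia.
  by have := hv _ _ ab bk; have := dn _ bk bi; lia.
- case: (eqVneq b l) => [bl|/(up _ bk)]; last by have := hv _ _ ba ak; lia.
  have al : a != l by lia.
  by have := hu _ _ ba ak; have := up _ ak al; lia.
- by case: (eqVneq a i) => [->|/(dn _ ak)->] //; lia.
Qed.

(** If raising [i] against [l] fails to raise the value once, then by the common pattern that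
    instance, read backwards, settles every exchange in favour of [l]; strictness comes from
    [pt_inj]. *)
Lemma beats_total k s i l : trace D k s -> i < k -> l < k -> i != l ->
  beats k s i l \/ beats k s l i.
Proof.
move=> ks ik lk il; have li : l != i by rewrite eq_sym.
apply: contrapT => /not_orP [ib]; apply=> N u v hu hv uv ul vi.
apply: contrapT => nuv; apply: ib => N1 u1 v1 hu1 hv1 uv1 ui1 vl1.
apply/negP => vu1; apply: nuv.
have vu x : x < k -> x != i -> x != l -> v x = u x.
  by move=> xk xi xl; rewrite uv.
have uv1' x : x < k -> x != l -> x != i -> v1 x = u1 x.
  by move=> xk xi xl; rewrite uv1.
apply: dlt_neq; [exact: pt_in|exact: pt_in| |]; last first.
  by case/(pt_inj ks ks hu hv) => _ _ /(_ i ik) ui; rewrite ui ltnn in vi.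
rewrite (dle_type ks ks hu hv hv1 hu1) // => a b ak bk.
- rewrite (exchange_pattern hv hu ik lk) //.
  by rewrite (exchange_pattern hu1 hv1 ik lk).
- rewrite (exchange_pattern hu hv lk ik) //.
  by rewrite (exchange_pattern hv1 hu1 lk ik).
Qed.

(* An index that beats all indices outside [S] decides once the arguments in
   [S] agree: raise it in small steps, while lowering the other arguments one
   after another to the minimum of the two configurations. *)
Definition wins k s (S : seq nat) w : Prop :=
  forall N u v, incr k N u -> incr k N v ->
  (forall x, x < k -> x \in S -> u x = v x) ->
  u w < v w -> dlt D N (pt D N k s u) (pt D N k s v).

Lemma beats_wins k s S w : trace D k s -> w < k -> w \notin S ->
  (forall l, l < k -> l \notin S -> l != w -> beats k s w l) ->
  wins k s S w.
Proof.
move=> ks wk wS wl N u v hu hv uv uvw.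
(* Scaling by [k.+1] makes room for raising the argument [w] by one in each of [k] steps without
   reaching the next scaled value. *)
pose c := k.+1.
have hc : incr N.+1 (c * N) (fun b => c * b).
  split=> [b b' bb' _|b]; first by rewrite ltn_pmul2l.
  by rewrite ltnS leq_pmul2l.
have hC : incr (c * N).+1 (c * N + c) id.
  by split=> // b; rewrite ltnS => /leq_trans; apply; rewrite leq_addr.
pose W a x := if x == w then c * u w + a
  else if x < a then c * minn (u x) (v x) else c * u x.
have cmul x y : x < y -> c * x + c <= c * y by move=> xy; rewrite addnC -mulnS leq_pmul2l.
have cmulE x y : x <= y -> c * x <= c * y by move=> xy; rewrite leq_pmul2l.
have hW a : a <= k -> incr k (c * N) (W a).
  move=> ak; split=> [x y xy yk|x xk]; rewrite /W.
    have uxy := hu.1 _ _ xy yk; have vxy := hv.1 _ _ xy yk.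
    case: (eqVneq x w) => [xw|xw]; case: (eqVneq y w) => [yw|yw]; subst.
    - by lia.
    - by case: ifP => _; [have := @cmul (u w) (minn (u y) (v y))|have := @cmul (u w) (u y)]; rewrite /c; lia.
    - by case: ifP => _; [have := @cmul (minn (u x) (v x)) (u w)|have := @cmul (u x) (u w)]; rewrite /c; lia.
    - case: ifP => xa; case: ifP => ya.
      + by have := @cmul (minn (u x) (v x)) (minn (u y) (v y)); rewrite /c; lia.
      + by have := @cmul (minn (u x) (v x)) (u y); rewrite /c; lia.
      + by lia.
      + by have := @cmul (u x) (u y); rewrite /c; lia.
  have ux := hu.2 _ xk; have vw := hv.2 _ wk.
  case: ifP => _; first by have := @cmul (u w) N; rewrite /c; lia.
  by case: ifP => _; apply: cmulE; lia.
have hV := incr_comp hv hc.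
rewrite -/(dlt _ _ _ _) /dlt -(dle_comp ks ks hv hu hc) -/(dlt _ _ _ _).
have step a : a < k -> dle D (c * N) (pt D (c * N) k s (W a)) (pt D (c * N) k s (W a.+1)).
  move=> ak; have ha := hW _ (ltnW ak); have hs := hW _ ak.
  (* In the first case no argument goes down and monotonicity suffices; otherwise [a] lies outside
     [S], and [w] is raised while [a] is lowered. *)
  case: (boolP ((a == w) || (u a <= v a))) => [easy|/norP[aw]].
    apply: pt_mono => // x xk; rewrite /W; case: ifP => // xw; first by lia.
    case: ifP => xa; case: ifP => xa' //; try lia.
    by have xE : x = a by [lia]; subst; rewrite xw /= in easy; apply: cmulE; lia.
  rewrite -ltnNge => vua; apply: dltW; try exact: pt_in.
  have aS : a \notin S by apply/negP=> /(uv _ ak) e; rewrite e ltnn in vua.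
  apply: (wl a) => //; rewrite /W ?eqxx //.
  - move=> x xk xw xa; rewrite (negbTE xw); congr (if _ then _ else _); lia.
  - by lia.
  - by rewrite (negbTE aw) ltnSn ltnn ltn_pmul2l //; lia.
have chain a : a <= k -> dle D (c * N) (pt D (c * N) k s (W 0)) (pt D (c * N) k s (W a)).
  elim: a => [_|a IH ak]; first by apply: dle_refl; apply: pt_in => //; exact: hW.
  by apply: dle_trans (IH (ltnW ak)) (step _ ak); apply: pt_in => //; apply: hW => //; exact: ltnW.
rewrite (@eq_pt D _ k s (fun i => c * u i) (W 0)); last first.
  by move=> x _; rewrite /W; case: eqP => [->|]; rewrite ?addn0.
apply: dle_lt_trans (chain k (leqnn k)) _; try (apply: pt_in => //; exact: hW).
apply: dlt_neq; try (apply: pt_in => //; exact: hW).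
  apply: pt_mono => //; first exact: hW.
  move=> x xk; rewrite /W xk; case: eqP => [->|_]; last by apply: cmulE; lia.
  by have := cmul _ _ uvw; rewrite /c; lia.
case/(pt_inj ks ks (hW k (leqnn k)) hV) => _ _ /(_ w wk).
by rewrite /W eqxx; have := cmul _ _ uvw; rewrite /c; lia.
Qed.

(** If no index outside [S] wins, then by [beats_wins] and [beats_total] each such index [w] is
    beaten by another one [f w] outside [S]; this contradicts monotonicity. *)
Lemma exists_winner k s (S : seq nat) x0 : trace D k s -> x0 < k -> x0 \notin S ->
  exists w, [/\ w < k, w \notin S & wins k s S w].
Proof.
move=> ks x0k x0S; apply: contrapT => none.
have /choice [f fP] : forall w, exists l, w < k -> w \notin S ->
    [/\ l < k, l \notin S, l != w & beats k s l w].
  move=> w; case: (boolP ((w < k) && (w \notin S))) => [/andP[wk wS]|/negP nw];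
    last by exists 0 => wk wS; case: nw; rewrite wk wS.
  apply: contrapT => nol; apply: none; exists w; split=> //.
  apply: beats_wins => // l lk lS lw.
  have wl : w != l by rewrite eq_sym.
  have [//|lb] := beats_total ks wk lk wl.
  by case: nol; exists l.
pose Q := [seq x <- iota 0 k | x \notin S].
have Qin x : (x \in Q) = (x \notin S) && (x < k).
  by rewrite mem_filter mem_iota.
have Qk : size Q <= k by rewrite size_filter -[leqRHS](size_iota 0 k) count_size.
(* Raising each index in turn by a lot, at the price of lowering its
   dominator a little, lowers the point although all arguments increase. *)
have [c cE] : exists c, c = 4 * k + 4 by eexists.
pose r a x := count (fun q => f q == x) (take a Q).
(* Each argument moves in a window of length [c] of its own: from the offset [2 * k] there is at
   most one gain of [k.+1] and at most [k] losses of 1. The gain outweighs all losses, and indices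
   in [S] suffer none, so in the end no argument is smaller than at the beginning. *)
pose V a x := x * c + 2 * k + k.+1 * (x \in take a Q) - r a x.
have rk a x : r a x <= k.
  apply: leq_trans (count_size _ _) _; rewrite size_take.
  by case: ltnP => // h; exact: leq_trans (ltnW h) Qk.
have hV a : incr k (k * c) (V a).
  split=> [x y xy yk|x xk].
    have xyc : x * c + c <= y * c by rewrite addnC -mulSn leq_mul2r xy orbT.
    have := rk a x; have := rk a y.
    by rewrite /V; case: (x \in _); case: (y \in _); rewrite /= ?muln1 ?muln0; lia.
  have xkc : x * c + c <= k * c by rewrite addnC -mulSn leq_mul2r xk orbT.
  by rewrite /V; case: (x \in _); rewrite /= ?muln1 ?muln0; lia.
pose p a := pt D (k * c) k s (V a).
have pin a : din D (k * c) (p a) by exact: pt_in.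
have step a : a < size Q -> dlt D (k * c) (p a.+1) (p a).
  move=> aQ; set q := nth 0 Q a.
  have takeS : take a.+1 Q = rcons (take a Q) q by rewrite (take_nth 0).
  have qQ : q \in Q by rewrite mem_nth.
  have uQ : uniq (take a.+1 Q) by rewrite take_uniq // filter_uniq // iota_uniq.
  have qt : q \notin take a Q by move: uQ; rewrite takeS rcons_uniq => /andP[].
  have [fk fS fq fb] : [/\ f q < k, f q \notin S, f q != q & beats k s (f q) q].
    by move: qQ; rewrite Qin => /andP[qS qk]; apply: fP.
  have rS x : r a.+1 x = r a x + (f q == x) by rewrite /r takeS -cats1 count_cat /= addn0.
  have inS x : (x \in take a.+1 Q) = (x == q) || (x \in take a Q).
    by rewrite takeS mem_rcons in_cons.
  apply: fb => //; rewrite /V ?rS ?inS.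
  - move=> x xk xf xq; rewrite rS inS (negbTE xq) [f q == x]eq_sym (negbTE xf).
    by rewrite addn0.
  - by rewrite eqxx (negbTE fq) /=; have := rk a (f q); lia.
  - by rewrite eqxx (negbTE qt) (negbTE fq) /=; have := rk a q; lia.
have chain a : a <= size Q -> dle D (k * c) (p a) (p 0).
  elim: a => [_|a IH aQ]; first exact: dle_refl.
  by apply: dle_trans (dltW _ _ (step _ aQ)) (IH (ltnW aQ)).
have Q0 : 0 < size Q.
  by have := Qin x0; rewrite x0S x0k; case: (Q).
have : dlt D (k * c) (p (size Q)) (p 0).
  rewrite -(prednK Q0); apply: dlt_le_trans (step _ _) (chain _ _) => //; lia.
apply/negP; rewrite negbK; apply: pt_mono => // x xk.
rewrite /V !take_size !take0 in_nil Qin xk andbT /r !take_size !take0 /=.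
case: (boolP (x \in S)) => xS /=; last by have := rk (size Q) x; rewrite /r take_size; lia.
rewrite (_ : count _ _ = 0) //; apply/eqP; rewrite -leqn0 leqNgt -has_count.
apply/hasPn=> y; rewrite Qin => /andP[yS yk].
by have [_ fyS _ _] := fP y yk yS; apply: contraNneq fyS => ->.
Qed.

Definition priority_list k s (ps : seq nat) : Prop :=
  [/\ size ps = k, uniq ps, {in ps, forall x, x < k}
    & forall i, i < k -> wins k s (take i ps) (nth 0 ps i)].

Lemma exists_priority_list k s : trace D k s -> exists ps, priority_list k s ps.
Proof.
move=> ks.
suff H m : m <= k -> exists ps, [/\ size ps = m, uniq ps, {in ps, forall x, x < k}
    & forall i, i < m -> wins k s (take i ps) (nth 0 ps i)].
  by have [ps ?] := H k (leqnn k); exists ps.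
elim: m => [_|m IH mk]; first by exists [::].
have [ps [sz un lt win]] := IH (ltnW mk).
have [x xk xps] : exists2 x, x < k & x \notin ps.
  apply: contrapT => no; have : size (iota 0 k) <= size ps.
    apply: uniq_leq_size (iota_uniq _ _) _ => x; rewrite mem_iota /= => xk.
    by apply: contrapT => /negP xps; apply: no; exists x.
  by rewrite size_iota sz leqNgt mk.
have [w [wk wps ww]] := exists_winner ks xk xps.
exists (rcons ps w); split.
- by rewrite size_rcons sz.
- by rewrite rcons_uniq wps.
- by move=> y; rewrite mem_rcons in_cons => /orP[/eqP->|/lt].
- move=> i; rewrite ltnS leq_eqVlt => /orP[/eqP->|im].
    by rewrite -sz -cats1 take_cat nth_cat ltnn subnn take0 cats0.
  by rewrite -cats1 take_cat nth_cat sz im; apply: win.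
Qed.

Definition prio k s i := nth 0 (xget [::] (priority_list k s)) i.

Lemma prioP k s : trace D k s ->
  priority_list k s (xget [::] (priority_list k s)).
Proof. by move=> /exists_priority_list; apply: xgetPex. Qed.

Lemma prio_lt k s i : trace D k s -> i < k -> prio k s i < k.
Proof. by move=> /prioP [sz _ h _] ik; apply/h/mem_nth; rewrite sz. Qed.

Lemma prio_inj k s i j : trace D k s -> i < k -> j < k ->
  prio k s i = prio k s j -> i = j.
Proof.
by move=> /prioP [sz un _ _] ik jk /eqP; rewrite nth_uniq ?sz // => /eqP.
Qed.

Lemma prio_surj k s x : trace D k s -> x < k -> exists2 i, i < k & prio k s i = x.
Proof.
move=> /prioP; rewrite /prio; set ps := xget _ _ => -[sz un lt _] xk.
have xps : x \in ps.
  have sub : {subset ps <= iota 0 k} by move=> y /lt; rewrite mem_iota.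
  by have [|_ ->] := uniq_min_size un sub; rewrite ?size_iota ?sz // mem_iota.
by exists (index x ps); rewrite ?nth_index // -sz index_mem.
Qed.

Lemma prio_wins k s i N u v : trace D k s -> i < k -> incr k N u -> incr k N v ->
  (forall i', i' < i -> u (prio k s i') = v (prio k s i')) ->
  u (prio k s i) < v (prio k s i) -> dlt D N (pt D N k s u) (pt D N k s v).
Proof.
move=> ks ik hu hv uv; have [sz _ _ win] := prioP ks.
apply: win => // x xk /(nthP 0) [i']; rewrite size_take sz ik => i'i <-.
by rewrite nth_take //; apply: uv.
Qed.

End Priorities.

(** * Comparing different terms *)

Section Links.
Variable D : predilator.

(** The rank of an argument among the anchors, read off from the term alone ([rank_anchors]); it
    names the gap between anchors in which the argument lies. *)
Definition prio_rank j k s x := count (fun i => prio D k s i <= x) (iota 0 j).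

Definition anchors j k s (u : nat -> nat) :=
  [seq u (prio D k s i) | i <- iota 0 j].

Definition shared j k s l t (u v : nat -> nat) : Prop :=
  forall i, i < j -> u (prio D k s i) = v (prio D l t i).

Lemma shared_anchors j k s l t u v : shared j k s l t u v ->
  anchors j k s u = anchors j l t v.
Proof. by move=> h; apply/eq_in_map => i; rewrite mem_iota => /h. Qed.

Lemma sharedC j k s l t u v : shared j k s l t u v -> shared j l t k s v u.
Proof. by move=> h i ij; rewrite h. Qed.

Lemma rank_anchors j k s N u x : trace D k s -> j <= k -> incr k N u -> x < k ->
  rank (anchors j k s u) (u x) = prio_rank j k s x.
Proof.
move=> ks jk hu xk; rewrite /rank count_map; apply: eq_in_count => i.
rewrite mem_iota /= => ij; rewrite (incr_leE hu) // (prio_lt ks) //.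
exact: leq_trans ij jk.
Qed.

Lemma blow_anchor j k s N u M z i : trace D k s -> j <= k -> incr k N u -> i < j ->
  blow M (anchors j k s u) z (u (prio D k s i)) =
  (4 * prio_rank j k s (prio D k s i)) * M.
Proof.
move=> ks jk hu ij; rewrite /blow map_f ?mem_iota // (rank_anchors ks jk hu) //.
exact/(prio_lt ks)/(leq_trans ij).
Qed.

Lemma blow_other j k s N u M z i : trace D k s -> incr k N u -> j <= i -> i < k ->
  let b := u (prio D k s i) in
  blow M (anchors j k s u) z b =
  (4 * prio_rank j k s (prio D k s i) + z b) * M + b.
Proof.
move=> ks hu ji ik /=; have jk := leq_trans ji (ltnW ik).
rewrite /blow (rank_anchors ks jk hu) ?(prio_lt ks) //.
case: ifP => // /mapP [i']; rewrite mem_iota /= => i'j e.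
have i'k : i' < k by exact: leq_trans i'j jk.
suff : i = i' by lia.
apply: (prio_inj ks) => //; apply/eqP; move/eqP: e.
by rewrite !eqn_leq !(incr_leE hu) ?(prio_lt ks).
Qed.

(** Zone 0 belongs to the anchors, and monotonicity makes [blow] increasing. *)
Definition zone (z : nat -> nat) : Prop :=
  (forall b, 1 <= z b <= 3) /\ (forall b c, b <= c -> z b <= z c).

Lemma zone_const c : 1 <= c <= 3 -> zone (fun => c).
Proof. by []. Qed.

Lemma zone_cut a : zone (fun b => if b <= a then 1 else 3).
Proof. by split=> [b|b c bc]; case: ifP => //; case: ifP => //; lia. Qed.

Lemma incr_blow_anchors M N j k s u z : zone z -> N < M ->
  incr N.+1 ((4 * j + 4) * M) (blow M (anchors j k s u) z).
Proof.
move=> [z1 z2] NM; rewrite -[j in 4 * j](size_iota 0 j).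
by rewrite -(size_map (fun i => u (prio D k s i))); apply: incr_blow.
Qed.

Lemma blow_lt M r a b x y : b < M -> x < y -> r = a -> forall c,
  (4 * r + x) * M + b < (4 * a + y) * M + c.
Proof.
move=> bM xy -> c; have : (4 * a + x).+1 * M <= (4 * a + y) * M.
  by rewrite leq_mul2r; lia.
by rewrite mulSn; lia.
Qed.

(* Blowing two configurations up over their anchors makes them share the first
   [j] priority arguments, after which the zones can be chosen such that the
   next argument decides. *)
Lemma merge_le j k s N1 N2 M u1 u2 z1 z2 : trace D k s -> j <= k ->
  incr k N1 u1 -> incr k N2 u2 -> zone z1 -> zone z2 -> N1 < M -> N2 < M ->
  (j < k -> z1 (u1 (prio D k s j)) < z2 (u2 (prio D k s j))) ->
  let p u z := pt D ((4 * j + 4) * M) k s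
                 (fun x => blow M (anchors j k s u) z (u x)) in
  dle D ((4 * j + 4) * M) (p u1 z1) (p u2 z2) /\
  (j < k -> dlt D ((4 * j + 4) * M) (p u1 z1) (p u2 z2)).
Proof.
move=> ks jk hu1 hu2 hz1 hz2 M1 M2 zz p.
have h1 := incr_comp hu1 (incr_blow_anchors j k s u1 hz1 M1).
have h2 := incr_comp hu2 (incr_blow_anchors j k s u2 hz2 M2).
have H : j < k -> dlt D ((4 * j + 4) * M) (p u1 z1) (p u2 z2).
  move=> jk'; apply: (@prio_wins _ k s j) => // [i ij|].
    by rewrite (blow_anchor _ _ ks jk hu1) // (blow_anchor _ _ ks jk hu2).
  rewrite (blow_other _ _ ks hu1) // (blow_other _ _ ks hu2) //.
  apply: blow_lt => //; last exact: zz.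
  by apply: leq_ltn_trans M1; apply: hu1.2; apply: prio_lt.
split=> //; case: (ltnP j k) => [/H|kj]; first by apply: dltW; apply: pt_in.
have jkE : j = k by apply/eqP; rewrite eqn_leq jk.
rewrite (_ : p u1 z1 = p u2 z2); first by apply: dle_refl; apply: pt_in.
apply: eq_pt => x xk; have [i ik <-] := prio_surj ks xk.
by rewrite (blow_anchor _ _ ks jk hu1) ?(blow_anchor _ _ ks jk hu2) // jkE.
Qed.

(** The first pair is placed in zone 2 and the second pair in zones 1 and 3 over the same anchors.
    By [merge_le] the value at [u2] is then at most that at [u1], and the value at [v1] at most that
    at [v2]; the known comparison joins the two. *)
Lemma transfer j k s l t N1 u1 v1 N2 u2 v2 z : trace D k s -> trace D l t ->
  j <= k -> j <= l -> incr k N1 u1 -> incr l N1 v1 -> shared j k s l t u1 v1 ->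
  incr k N2 u2 -> incr l N2 v2 -> shared j k s l t u2 v2 -> zone z ->
  (j < k -> z (u2 (prio D k s j)) = 1) -> (j < l -> z (v2 (prio D l t j)) = 3) ->
  dle D N1 (pt D N1 k s u1) (pt D N1 l t v1) ->
  dle D N2 (pt D N2 k s u2) (pt D N2 l t v2) /\
  (j < k -> dlt D N2 (pt D N2 k s u2) (pt D N2 l t v2)).
Proof.
move=> ks lt jk jl hu1 hv1 s1 hu2 hv2 s2 hz z2 z3 h.
pose M := (N1 + N2).+1.
have M1 : N1 < M by rewrite /M; lia.
have M2 : N2 < M by rewrite /M; lia.
have hz2 : zone (fun => 2) by exact: zone_const.
have he1 := incr_blow_anchors j k s u1 hz2 M1.
have he2 := incr_blow_anchors j k s u2 hz M2.
rewrite /dlt -(dle_comp ks lt hu2 hv2 he2) -(dle_comp lt ks hv2 hu2 he2).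
move: h; rewrite -(dle_comp ks lt hu1 hv1 he1) => h.
have [ules ult] := @merge_le j k s N2 N1 M u2 u1 _ _ ks jk hu2 hu1 hz hz2 M2 M1
  (fun jk' => eq_ind_r (fun a => a < 2) (isT : 1 < 2) (z2 jk')).
have [vles _] := @merge_le j l t N1 N2 M v1 v2 _ _ lt jl hv1 hv2 hz2 hz M1 M2
  (fun jl' => eq_ind_r (fun a => 2 < a) (isT : 2 < 3) (z3 jl')).
rewrite -(shared_anchors s1) -(shared_anchors s2) in vles.
have i1 := pt_in ks (incr_comp hu1 he1); have i2 := pt_in ks (incr_comp hu2 he2).
have i3 := pt_in lt (incr_comp hv1 he1); have i4 := pt_in lt (incr_comp hv2 he2).
have le1 := dle_trans i1 i3 i4 h vles.
split; first exact: dle_trans ules le1.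
by move=> /ult ult'; apply: dlt_le_trans ult' le1.
Qed.

Definition dominated j k s l t : Prop := forall N u v,
  incr k N u -> incr l N v -> shared j k s l t u v ->
  dlt D N (pt D N l t v) (pt D N k s u).

(** Besides letting the [j]-th priority argument decide, a link fixes the relative order of the
    first [j.+1] priority positions; these orders later fit together into the thread. *)
Definition link j k s l t : Prop :=
  [/\ j < k, j < l,
      forall i i', i <= j -> i' <= j ->
        (prio D k s i <= prio D k s i') = (prio D l t i <= prio D l t i') &
      forall N u v, incr k N u -> incr l N v -> shared j k s l t u v ->
        (u (prio D k s j) < v (prio D l t j) ->
           dlt D N (pt D N k s u) (pt D N l t v)) /\
        (v (prio D l t j) < u (prio D k s j) ->
           dlt D N (pt D N l t v) (pt D N k s u))].

Lemma dlt_asym N x y : dlt D N x y -> ~ dle D N y x.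
Proof. by move/negP. Qed.

(** If the first term does not always dominate, both outcomes of the comparison occur. Without a
    [j]-th argument on one side, [transfer] would turn one outcome into the other; otherwise the
    zones cut at the [j]-th argument give the two halves of the link. *)
Lemma dominated_or_link j k s l t N u v : trace D k s -> trace D l t ->
  j <= k -> j <= l -> incr k N u -> incr l N v -> shared j k s l t u v ->
  dlt D N (pt D N l t v) (pt D N k s u) ->
  dominated j k s l t \/ link j k s l t.
Proof.
move=> ks lt jk jl hu hv suv vu.
have [|nd] := pselect (dominated j k s l t); [by left|right].
have [N1 [u1 [v1 [hu1 hv1 s1 h1]]]] : exists N1 u1 v1, [/\ incr k N1 u1,
    incr l N1 v1, shared j k s l t u1 v1 & dle D N1 (pt D N1 k s u1) (pt D N1 l t v1)].
  apply: contrapT => no; apply: nd => N1 u1 v1 hu1 hv1 s1.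
  by apply/negP => h; apply: no; exists N1, u1, v1.
have jk' : j < k.
  rewrite ltnNge; apply/negP => kj.
  have [h _] := @transfer j k s l t N1 u1 v1 N u v (fun => 3) ks lt jk jl hu1 hv1 s1
    hu hv suv (@zone_const 3 isT) (fun a => ltac:(lia)) (fun=> erefl) h1.
  exact: dlt_asym vu h.
have jl' : j < l.
  rewrite ltnNge; apply/negP => lj.
  have [h _] := @transfer j k s l t N1 u1 v1 N u v (fun => 1) ks lt jk jl hu1 hv1 s1
    hu hv suv (@zone_const 1 isT) (fun=> erefl) (fun a => ltac:(lia)) h1.
  exact: dlt_asym vu h.
have up N2 u2 v2 : incr k N2 u2 -> incr l N2 v2 -> shared j k s l t u2 v2 ->
    u2 (prio D k s j) < v2 (prio D l t j) -> dlt D N2 (pt D N2 k s u2) (pt D N2 l t v2).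
  move=> hu2 hv2 s2 lt2.
  apply: (transfer ks lt jk jl hu1 hv1 s1 hu2 hv2 s2 (zone_cut (u2 (prio D k s j)))
    _ _ h1).2 => // _; first by rewrite leqnn.
  by rewrite leqNgt lt2.
have down N2 u2 v2 : incr k N2 u2 -> incr l N2 v2 -> shared j k s l t u2 v2 ->
    v2 (prio D l t j) < u2 (prio D k s j) -> dlt D N2 (pt D N2 l t v2) (pt D N2 k s u2).
  move=> hu2 hv2 s2 lt2.
  apply: (transfer lt ks jl jk hv hu (sharedC suv) hv2 hu2 (sharedC s2)
    (zone_cut (v2 (prio D l t j))) _ _ (dltW _ _ vu)).2 => //; try exact: pt_in.
    by move=> _; rewrite leqnn.
  by move=> _; rewrite leqNgt lt2.
(* Opposite positions of [i] and [j] in the two terms would let the shared [i]-th argument separate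
   the [j]-th ones, against one of the two known outcomes. *)
have pat i : i < j -> (prio D k s i <= prio D k s j) = (prio D l t i <= prio D l t j).
  move=> ij; have ik := ltn_trans ij jk'; have il := ltn_trans ij jl'.
  apply/idP/idP => h; apply: contrapT => /negP; rewrite -ltnNge => h'.
  - apply: (dlt_asym (down N1 u1 v1 hu1 hv1 s1 _) h1).
    apply: (@leq_trans (v1 (prio D l t i))).
      by rewrite (incr_ltE hv1) // prio_lt.
    by rewrite -s1 // (incr_leE hu1) // prio_lt.
  - apply: (dlt_asym (up N u v hu hv suv _) (dltW _ _ vu)); try exact: pt_in.
    apply: (@leq_trans (u (prio D k s i))).
      by rewrite (incr_ltE hu) // prio_lt.
    by rewrite suv // (incr_leE hv) // prio_lt.
have ple k' s' i i' : trace D k' s' -> i < k' -> i' < k' -> i != i' ->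
    (prio D k' s' i <= prio D k' s' i') = ~~ (prio D k' s' i' <= prio D k' s' i).
  move=> ks' ik ik' ne; rewrite -ltnNge ltn_neqAle.
  by case: eqP => // /(prio_inj ks' ik ik') /eqP; rewrite (negbTE ne).
split=> // [i i' ij i'j|N2 u2 v2 hu2 hv2 s2]; last first.
  by split; [exact: up|exact: down].
case: (ltngtP i j) ij => // [ij _|-> _];
    case: (ltngtP i' j) i'j => // [i'j _|-> _].
- have pk h := prio_lt ks (ltn_trans h jk'); have pl h := prio_lt lt (ltn_trans h jl').
  by rewrite -(incr_leE hu (pk _ ij) (pk _ i'j)) -(incr_leE hv (pl _ ij) (pl _ i'j)) !suv.
- exact: pat.
- have ne : j != i' by lia.
  have i'k := ltn_trans i'j jk'; have i'l := ltn_trans i'j jl'.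
  by rewrite (ple _ _ _ _ ks jk' i'k ne) (ple _ _ _ _ lt jl' i'l ne) pat.
- by rewrite !leqnn.
Qed.

(** Both links start from the same term; this form fits [ev_linked], which links all later terms to
    a single one. *)
Lemma link_trans j k s l t l' t' : trace D k s -> trace D l t -> trace D l' t' ->
  link j k s l t -> link j k s l' t' -> link j l t l' t'.
Proof.
move=> ks lt lt' [jk jl pat lk] [_ jl' pat' lk'].
have rk i : i <= j -> prio_rank j l t (prio D l t i) = prio_rank j k s (prio D k s i).
  move=> ij; apply: eq_in_count => i'; rewrite mem_iota /= => i'j.
  by rewrite -pat // ltnW.
have rk' i : i <= j -> prio_rank j l' t' (prio D l' t' i) = prio_rank j k s (prio D k s i).
  move=> ij; apply: eq_in_count => i'; rewrite mem_iota /= => i'j.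
  by rewrite -pat' // ltnW.
split=> // [i i' ij i'j|N u v hu hv suv]; first by rewrite -pat // pat'.
(* A configuration of the first trace is inserted between the two given ones. *)
pose a := minn (u (prio D l t j)) (v (prio D l' t' j)).
pose M := (N + k).+1.
have NM : N < M by rewrite /M; lia.
have kM : k < M by rewrite /M; lia.
(* If the two [j]-th arguments differ, the cut at their minimum sends the smaller to zone 1 and the
   larger to zone 3, on either side of the inserted one in zone 2. *)
have hz := zone_cut a; have hz2 : zone (fun => 2) by exact: zone_const.
have hw : incr k k id by split=> // i /ltnW.
have he := incr_blow_anchors j l t u hz NM.
have hf := incr_blow_anchors j k s id hz2 kM.
have hef := incr_comp hw hf.
set e := blow _ _ _ in he; set f := blow _ _ _ in hf hef.
have sh : shared j k s l t (fun x => f x) (fun x => e (u x)).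
  move=> i ij; rewrite /e /f (blow_anchor _ _ lt (ltnW jl) hu) //.
  by rewrite (blow_anchor _ _ ks (ltnW jk) hw) // rk // ltnW.
have sh' : shared j k s l' t' (fun x => f x) (fun x => e (v x)).
  by move=> i ij; rewrite sh // suv.
have fj : f (prio D k s j) = (4 * prio_rank j k s (prio D k s j) + 2) * M + prio D k s j.
  by rewrite /f (blow_other _ _ ks hw).
have ej : let y := u (prio D l t j) in
    e y = (4 * prio_rank j k s (prio D k s j) + (if y <= a then 1 else 3)) * M + y.
  by rewrite /e (blow_other _ _ lt hu) // rk.
have ej' : let y := v (prio D l' t' j) in
    e y = (4 * prio_rank j k s (prio D k s j) + (if y <= a then 1 else 3)) * M + y.
  by rewrite /e (shared_anchors suv) (blow_other _ _ lt' hv) // rk'.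
have ub : u (prio D l t j) < M by apply: leq_ltn_trans NM; apply: hu.2; apply: prio_lt.
have vb : v (prio D l' t' j) < M by apply: leq_ltn_trans NM; apply: hv.2; apply: prio_lt.
have fb : prio D k s j < M by apply: ltn_trans kM; apply: prio_lt.
have hu' := incr_comp hu he; have hv' := incr_comp hv he.
have [su su'] := lk _ _ _ hef hu' sh; have [sv sv'] := lk' _ _ _ hef hv' sh'.
have iu := pt_in lt hu'; have iv := pt_in lt' hv'; have iw := pt_in ks hef.
rewrite /dlt -(dle_comp lt lt' hu hv he) -(dle_comp lt' lt hv hu he).
rewrite -!/(dlt _ _ _ _).
split=> h.
- have ua : u (prio D l t j) <= a by rewrite /a; lia.
  have va : v (prio D l' t' j) <= a = false by rewrite /a; lia.
  apply: (dlt_le_trans iu iw iv); last apply: dltW => //.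
    by apply: su'; rewrite fj ej ua; apply: blow_lt.
  by apply: sv; rewrite fj ej' va; apply: blow_lt.
- have ua : u (prio D l t j) <= a = false by rewrite /a; lia.
  have va : v (prio D l' t' j) <= a by rewrite /a; lia.
  apply: (dlt_le_trans iv iw iu); last apply: dltW => //.
    by apply: sv'; rewrite fj ej' va; apply: blow_lt.
  by apply: su; rewrite fj ej ua; apply: blow_lt.
Qed.

End Links.

(** * Extended predilators *)

Section Extensions.
Variables (D : predilator) (T : choiceType) (B : ord T).
Hypothesis B_linear : linear_order B.

Let refl := let: And4 r _ _ _ := B_linear in r.
Let anti := let: And4 _ a _ _ := B_linear in a.
Let trans := let: And4 _ _ t _ := B_linear in t.
Let total := let: And4 _ _ _ t := B_linear in t.

Definition enumerates k (g : nat -> T) : Prop :=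
  (forall i, i < k -> g i \in odom B) /\
  (forall i j, i < k -> j < k -> ole B (g i) (g j) = (i <= j)).

Definition img s k (g : nat -> T) : nat * {fset T} :=
  (s, [fset g i | i in iota 0 k]%fset).

Lemma sort_odom_sorted (s : seq T) : all (odom B) s -> sorted (ole B) (sort (ole B) s).
Proof. by apply: sort_sorted_in => x y; apply: total. Qed.

Lemma sort_odom_eq (s r : seq T) : all (odom B) s -> sorted (ole B) r ->
  perm_eq s r -> sort (ole B) s = r.
Proof.
move=> so rs sr; have mem : {subset sort (ole B) s <= odom B}.
  by move=> x; rewrite mem_sort => /(allP so).
have tr : {in sort (ole B) s & &, transitive (ole B)}.
  by move=> x y z xs ys zs; apply: trans; apply: mem.
have an : {in sort (ole B) s &, antisymmetric (ole B)}.
  by move=> x y xs ys; apply: anti; apply: mem.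
apply: (sorted_eq_in tr an) => //; first exact: sort_odom_sorted.
by rewrite perm_sort.
Qed.

Lemma index_sort (s : seq T) x y : all (odom B) s -> x \in s -> y \in s ->
  (index x (sort (ole B) s) <= index y (sort (ole B) s)) = ole B x y.
Proof.
move=> so xs ys; have mem : {subset sort (ole B) s <= odom B}.
  by move=> z; rewrite mem_sort => /(allP so).
have xo := allP so x xs; have yo := allP so y ys.
have H : {in sort (ole B) s &, forall x y,
    index x (sort (ole B) s) <= index y (sort (ole B) s) -> ole B x y}.
  apply: sorted_leq_index_in.
  - by move=> a b c as_ bs cs; apply: trans; apply: mem.
  - by move=> a /mem; apply: refl.
  - exact: sort_odom_sorted.
apply/idP/idP => [|xy]; first by apply: H; rewrite mem_sort.
case: (leqP (index x (sort (ole B) s))) => // yx.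
have yx' : ole B y x by apply: H; rewrite ?mem_sort // ltnW.
by move: yx; rewrite (anti xo yo) ?ltnn // xy yx'.
Qed.

Lemma enumerates_sort (s : seq T) x0 : all (odom B) s -> uniq s ->
  enumerates (size s) (nth x0 (sort (ole B) s)).
Proof.
move=> so un; have ms i : i < size s -> nth x0 (sort (ole B) s) i \in s.
  by move=> h; rewrite -(mem_sort (ole B)) mem_nth // size_sort.
split=> [i /ms /(allP so) //|i j si sj].
by rewrite -(index_sort so (ms _ si) (ms _ sj)) !index_uniq ?size_sort ?sort_uniq.
Qed.

Lemma enumerates_inj k g i j : enumerates k g -> i < k -> j < k -> g i = g j -> i = j.
Proof.
move=> [go gm] ik jk e; apply/eqP.
by rewrite eqn_leq -(gm _ _ ik jk) -(gm _ _ jk ik) e refl // go.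
Qed.

Lemma sort_img s k g : enumerates k g ->
  sort (ole B) (img s k g).2 = map g (iota 0 k).
Proof.
move=> hg; have [go gm] := hg; apply: sort_odom_eq.
- by apply/allP=> x /imfsetP [i /=]; rewrite mem_iota => /andP[_ ik] ->; exact: go.
- rewrite sorted_map; apply: (@sub_in_sorted _ [pred i | i < k] leq).
  + by move=> i j ik jk ij; rewrite /= gm.
  + by apply/allP=> i; rewrite mem_iota.
  + exact: iota_sorted.
- apply: uniq_perm; first exact: fset_uniq.
    rewrite map_inj_in_uniq ?iota_uniq // => i j.
    by rewrite !mem_iota; exact: enumerates_inj hg.
  by move=> x; apply/imfsetP/mapP => -[i h ->]; exists i.
Qed.

Lemma card_img s k g : enumerates k g -> #|` (img s k g).2|%fset = k.
Proof.
by move=> /(sort_img s) /(congr1 size); rewrite size_sort size_map size_iota.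
Qed.

Lemma img_in s k g : trace D k s -> enumerates k g -> img s k g \in odom (Dbar B D).
Proof.
move=> [sD ss] hg; rewrite inE /= (card_img s hg) ss eqxx andbT sD andbT.
by apply/allP=> x /imfsetP [i /=]; rewrite mem_iota => /andP[_ ik] ->; exact: hg.1.
Qed.

Lemma img_of_mem x0 p : p \in odom (Dbar B D) ->
  [/\ trace D #|` p.2|%fset p.1,
      enumerates #|` p.2|%fset (nth x0 (sort (ole B) p.2))
    & p = img p.1 #|` p.2|%fset (nth x0 (sort (ole B) p.2))].
Proof.
case: p => s a; rewrite inE /= => /and3P [ao sD /eqP ss]; split=> //.
  exact: enumerates_sort ao (fset_uniq a).
rewrite /img; congr pair; apply/fsetP=> x; apply/idP/imfsetP => /= [xa|[i]].
  exists (index x (sort (ole B) a)).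
    by rewrite mem_iota /= add0n -[X in _ < X](size_sort (ole B)) index_mem mem_sort.
  by rewrite nth_index // mem_sort.
rewrite mem_iota /= add0n => ia ->.
by rewrite -(mem_sort (ole B)) mem_nth // size_sort.
Qed.

(** The common codomain of two inclusions may be empty, whereas points live over [N.+1]; hence both
    sides are moved along the inclusion of [N] into [N.+1]. The equations between dimensions are
    hypotheses so that they can be substituted away. *)
Lemma pd_le_dle m1 m2 n k l N (f : {ffun 'I_m1 -> 'I_n}) (g : {ffun 'I_m2 -> 'I_n})
    s t u v : m1 = k -> m2 = l -> increasing f -> increasing g ->
  incr k n u -> incr l n v ->
  (forall i, f i = u i :> nat) -> (forall i, g i = v i :> nat) -> n = N ->
  s \in odom (pd_ob D k) -> t \in odom (pd_ob D l) ->
  ole (pd_ob D n) (pd_mor D f s) (pd_mor D g t) = dle D N (pt D N k s u) (pt D N l t v).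
Proof.
move=> ? ? hf hg hu hv fu gv ? sD tD; subst.
pose w := [ffun i : 'I_N => widen_ord (leqnSn N) i].
have hw : increasing w by move=> i j ij; rewrite !ffunE.
have [_ wE] := pd_embedding D hw.
rewrite -wE; [|exact: (pd_embedding D hf).1|exact: (pd_embedding D hg).1].
rewrite -!pd_comp //; rewrite /dle /pt; congr (ole _ _ _); congr (pd_mor D _ _);
  apply/ffunP=> i; apply: val_inj; rewrite /= ev_val // !ffunE /= ?fu ?gv //.
Qed.

(** By [dle_type] only the relative position of the arguments counts, so the enumeration of the
    union may be replaced by any [h] that reflects the order between them. *)
Lemma Dbar_img_le N s t k l g g' (h : T -> nat) :
  trace D k s -> trace D l t -> enumerates k g -> enumerates l g' ->
  incr k N (fun i => h (g i)) -> incr l N (fun i => h (g' i)) ->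
  (forall i j, i < k -> j < l -> (h (g i) <= h (g' j)) = ole B (g i) (g' j)) ->
  (forall i j, i < k -> j < l -> (h (g' j) <= h (g i)) = ole B (g' j) (g i)) ->
  ole (Dbar B D) (img s k g) (img t l g') =
  dle D N (pt D N k s (fun i => h (g i))) (pt D N l t (fun i => h (g' i))).
Proof.
move=> ks lt hg hg' ih ih' hle hge.
rewrite [LHS]/=.
set a := [fset g i | i in iota 0 k]%fset; set b := [fset g' i | i in iota 0 l]%fset.
have ak : #|` a|%fset = k := card_img s hg.
have bl : #|` b|%fset = l := card_img t hg'.
have sa : sort (ole B) a = map g (iota 0 k) := sort_img s hg.
have sb : sort (ole B) b = map g' (iota 0 l) := sort_img t hg'.
have aS x : (x \in a) = (x \in map g (iota 0 k)) by rewrite -sa mem_sort.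
have bS x : (x \in b) = (x \in map g' (iota 0 l)) by rewrite -sb mem_sort.
have ao : all (odom B) a.
  by apply/allP=> x; rewrite aS => /mapP [i]; rewrite mem_iota => ik ->; apply: hg.1.
have bo : all (odom B) b.
  by apply/allP=> x; rewrite bS => /mapP [i]; rewrite mem_iota => ik ->; apply: hg'.1.
have abo : all (odom B) (a `|` b)%fset.
  by apply/allP=> x; rewrite in_fsetU => /orP[/(allP ao)|/(allP bo)].
set S := sort (ole B) (a `|` b)%fset.
have ina i : i < k -> g i \in (a `|` b)%fset.
  by move=> ik; rewrite in_fsetU aS map_f ?mem_iota.
have inb i : i < l -> g' i \in (a `|` b)%fset.
  by move=> ik; rewrite in_fsetU bS orbC map_f ?mem_iota.
have iu : incr k #|` a `|` b|%fset (fun i => index (g i) S).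
  split=> [i j ij jk|i ik]; last by rewrite -(size_sort (ole B)) index_size.
  have ik := ltn_trans ij jk.
  by rewrite ltnNge (index_sort abo) ?ina // hg.2 // -ltnNge.
have iv : incr l #|` a `|` b|%fset (fun i => index (g' i) S).
  split=> [i j ij jk|i ik]; last by rewrite -(size_sort (ole B)) index_size.
  have ik := ltn_trans ij jk.
  by rewrite ltnNge (index_sort abo) ?inb // hg'.2 // -ltnNge.
have fa i : incl_shape B (fsubsetUl a b) i = index (g i) S :> nat.
  rewrite ffunE /= (tnth_nth (g i)) /= sa (nth_map 0) ?nth_iota ?size_iota //.
    by rewrite -ak.
  by rewrite -ak.
have fb i : incl_shape B (fsubsetUr a b) i = index (g' i) S :> nat.
  rewrite ffunE /= (tnth_nth (g' i)) /= sb (nth_map 0) ?nth_iota ?size_iota //.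
    by rewrite -bl.
  by rewrite -bl.
rewrite (@pd_le_dle _ _ _ k l #|` a `|` b|%fset _ _ s t _ _ ak bl _ _ iu iv fa fb erefl ks.1 lt.1).
- apply: dle_type => // i j ik jl; rewrite (index_sort abo) ?ina ?inb //.
    by rewrite hle.
  by rewrite hge.
- by move=> i j ij; rewrite !fa iu.1 // -ak.
- by move=> i j ij; rewrite !fb iv.1 // -bl.
Qed.

Lemma linear_embedding (s : seq T) : all (odom B) s -> exists N (h : T -> nat),
  (forall x, x \in s -> h x <= N) /\
  {in s &, forall x y, (h x <= h y) = ole B x y}.
Proof.
move=> so; exists (size s), (fun x => index x (sort (ole B) s)); split=> [x _|x y xs ys].
  by rewrite -(size_sort (ole B)) index_size.
exact: index_sort.
Qed.

Lemma Dbar_img_points s t k l g g' : trace D k s -> trace D l t ->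
  enumerates k g -> enumerates l g' ->
  exists N u v, [/\ incr k N u, incr l N v,
    forall i j, i < k -> j < l -> (u i <= v j) = ole B (g i) (g' j),
    forall i j, i < k -> j < l -> (v j <= u i) = ole B (g' j) (g i) &
    ole (Dbar B D) (img s k g) (img t l g') = dle D N (pt D N k s u) (pt D N l t v) /\
    ole (Dbar B D) (img t l g') (img s k g) = dle D N (pt D N l t v) (pt D N k s u)].
Proof.
move=> ks lt hg hg'.
have [|N [h [hN hle]]] := @linear_embedding (map g (iota 0 k) ++ map g' (iota 0 l)).
  rewrite all_cat; apply/andP; split; apply/allP => x /mapP [i];
  by rewrite mem_iota => ik ->; (apply: hg.1 || apply: hg'.1).
have ing i : i < k -> g i \in map g (iota 0 k) ++ map g' (iota 0 l).
  by move=> ik; rewrite mem_cat map_f ?mem_iota.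
have ing' i : i < l -> g' i \in map g (iota 0 k) ++ map g' (iota 0 l).
  by move=> ik; rewrite mem_cat orbC map_f ?mem_iota.
have iu : incr k N (fun i => h (g i)).
  split=> [i j ij jk|i ik]; last exact/hN/ing.
  have ik := ltn_trans ij jk.
  by rewrite ltnNge hle ?ing // hg.2 // -ltnNge.
have iv : incr l N (fun i => h (g' i)).
  split=> [i j ij jk|i ik]; last exact/hN/ing'.
  have ik := ltn_trans ij jk.
  by rewrite ltnNge hle ?ing' // hg'.2 // -ltnNge.
exists N, (fun i => h (g i)), (fun i => h (g' i)); split=> //.
- by move=> i j ik jl; rewrite hle ?ing ?ing'.
- by move=> i j ik jl; rewrite hle ?ing ?ing'.
- by split; apply: Dbar_img_le => // i j ik jl; rewrite hle ?ing ?ing'.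
Qed.

End Extensions.

(** * Oracles and negligible sets of runs *)

Lemma npair_inj i j i' j' : npair i j = npair i' j' -> i = i' /\ j = j'.
Proof.
rewrite /npair => e; have : i + j = i' + j' by case: (ltngtP (i + j) (i' + j')) => //; nia.
by move=> s; move: e; rewrite s; lia.
Qed.

Lemma leq_npairl i j : i <= npair i j.
Proof. by rewrite /npair leq_addl. Qed.

Lemma Dbar_elt_code_inj : injective Dbar_elt_code.
Proof.
move=> [s a] [t b] /npair_inj [/= -> /(can_inj CodeSeq.codeK) e].
by congr pair; apply/fsetP => x; rewrite -(mem_sort leq) e mem_sort.
Qed.

Definition pair_term t u := Plus (Times (Plus t u) (Plus t u)) t.

Lemma column_in M Y k : omega_model RCA0 M -> M Y ->
  M [set x | Y (npair k x)]%classic.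
Proof.
(* Variable 0 is a dummy bound by the quantifier of the Sigma or Pi form; 1 is the element and 2 the
   parameter [k]. *)
move=> hM MY; pose p := In (pair_term (Var 2) (Var 1)) 0.
have bp : bounded p by constructor.
have S1 : Sigma01 (Ex p) by exists p.
have P1 : Pi01 (All p) by exists p.
have [|X MX /= h] := hM _ (ax_comprehension S1 P1) (fun=> k) (fun=> Y) (fun=> MY).
  by move=> n /=; split=> [[_ h] _|h]; [exact: h|exists 0; exact: (h 0)].
suff <- : X = [set x | Y (npair k x)]%classic by [].
apply/predeqP=> x; split=> [/(h x).1 [_ //]|Yx].
by apply: (h x).2; exists 0.
Qed.

Definition run := (ord nat * (nat -> nat * {fset nat}))%type.

Definition run_support (r : run) n : seq nat :=
  flatten [seq enum_fset (r.2 i).2 | i <- iota 0 n].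

Definition agree (r r' : run) n : Prop :=
  (forall i, i < n -> r.2 i = r'.2 i) /\
  {in run_support r n &, ole r.1 =2 ole r'.1}.

Lemma run_supportP r n x :
  reflect (exists2 i, i < n & x \in (r.2 i).2) (x \in run_support r n).
Proof.
apply: (iffP flatten_mapP) => [[i]|[i ni xi]]; last by exists i; rewrite ?mem_iota.
by rewrite mem_iota => ni xi; exists i.
Qed.

Lemma agree_support r r' n : agree r r' n -> run_support r n = run_support r' n.
Proof.
move=> [h _]; congr flatten; apply/eq_in_map=> i; rewrite mem_iota => /andP[_ ni].
by rewrite h.
Qed.

Lemma agree_le r r' m n : n <= m -> agree r r' m -> agree r r' n.
Proof.
move=> nm [h h']; split=> [i ni|x y]; first by apply: h; exact: leq_trans ni nm.
move=> /run_supportP [i ni xi] /run_supportP [j nj yj].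
by apply: h'; apply/run_supportP; [exists i|exists j] => //; exact: leq_trans nm.
Qed.

Definition run_facts (r : run) n : seq nat :=
  [seq npair i (Dbar_elt_code (r.2 i)) | i <- iota 0 n].

Definition order_facts (r : run) n : seq nat :=
  [seq npair p.1 p.2 | p <- [seq (x, y) | x <- run_support r n, y <- run_support r n]
     & ole r.1 p.1 p.2].

(** The first component makes the code exceed every listed fact, so that a quantifier over the facts
    of a code can be bounded by the code itself. *)
Definition facts_code (c : seq nat * seq nat) :=
  npair (sumn (c.1 ++ c.2)).+1 (choice.pickle c).

Lemma facts_code_inj : injective facts_code.
Proof. by move=> c c' /npair_inj [_ /(pcan_inj choice.pickleK)]. Qed.

Lemma facts_lt c i : i \in c.1 ++ c.2 -> i < facts_code c.
Proof.
move=> ic; apply: leq_trans (leq_npairl _ _); rewrite ltnS.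
elim: (c.1 ++ c.2) ic => //= x s IH; rewrite in_cons => /orP[/eqP->|/IH]; lia.
Qed.

Section Negligible.
Variable D : predilator.

Definition descent (r : run) : Prop :=
  linear_order r.1 /\ forall n, olt (Dbar r.1 D) (r.2 n.+1) (r.2 n).

Lemma descent_in r n : descent r -> r.2 n \in odom (Dbar r.1 D).
Proof. by move=> [_ /(_ n)] /and4P[]. Qed.

Lemma descent_support r n x : descent r -> x \in run_support r n -> x \in odom r.1.
Proof.
move=> h /run_supportP [i _]; have := descent_in i h.
by rewrite inE => /andP[/allP a _] /a.
Qed.

(** Positive facts suffice: if [x] is below [y] in the second order but not in the first, then
    totality of the first yields the converse fact, and antisymmetry of the second gives [x = y]. *)
Lemma facts_agree r r' n : descent r -> descent r' ->
  (forall i, i \in run_facts r n -> graph_code (fun n => Dbar_elt_code (r'.2 n)) i) ->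
  (forall i, i \in order_facts r n -> ord_code r'.1 i) ->
  agree r r' n.
Proof.
move=> hr hr' hf ha.
have e i : i < n -> r.2 i = r'.2 i.
  move=> ni; have [|m] := hf (npair i (Dbar_elt_code (r.2 i))).
    by apply/mapP; exists i; rewrite ?mem_iota.
  by move=> /npair_inj [->] /Dbar_elt_code_inj.
have s : run_support r n = run_support r' n.
  by congr flatten; apply/eq_in_map=> i; rewrite mem_iota => /andP[_ ni]; rewrite e.
have imp x y : x \in run_support r n -> y \in run_support r n ->
    ole r.1 x y -> ole r'.1 x y.
  move=> xs ys xy; have [|a [b [_ _ ab]]] := ha (npair x y).
    by apply/mapP; exists (x, y) => //; rewrite mem_filter /= xy allpairs_f.
  by move=> /npair_inj [-> ->].
split=> // x y xs ys; apply/idP/idP; first exact: imp.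
move=> xy; have [_ _ _ tot] := hr.1; have [refl' anti' _ _] := hr'.1.
have xo := descent_support hr xs; have yo := descent_support hr ys.
have /orP[//|yx] := tot x y xo yo.
rewrite s in xs ys; have xo' := descent_support hr' xs; have yo' := descent_support hr' ys.
rewrite -s in xs ys; have -> : x = y by apply: anti' => //; rewrite xy imp.
by have [r0 _ _ _] := hr.1; exact: r0.
Qed.

Definition run_in (M : set (set nat)) (r : run) : Prop :=
  M (ord_code r.1) /\ M (graph_code (fun n => Dbar_elt_code (r.2 n))).

(* Any operation on runs each bit of whose value depends on a finite part of
   the run is computable relative to some oracle [Y], which lists the finite
   parts together with the bits that they determine. *)
Lemma continuous_in (K : run -> Prop) (G : run -> set nat) :
  (forall r x, descent r -> K r -> exists n, forall r', descent r' -> K r' ->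
     agree r r' n -> G r x <-> G r' x) ->
  exists Y : set nat, forall M, omega_model RCA0 M -> M Y ->
    forall r, descent r -> K r -> run_in M r -> M (G r).
Proof.
move=> cont.
pose code r n := facts_code (run_facts r n, order_facts r n).
pose det (b : bool) c x := exists r n, [/\ descent r, K r, c = code r n &
  forall r', descent r' -> K r' -> agree r r' n -> if b then G r' x else ~ G r' x].
pose part (b : bool) c i := exists s : seq nat * seq nat,
  c = facts_code s /\ i \in if b then s.1 else s.2.
(* The oracle combines four relations: 0 and 1 say that the finite part [c] forces [x] into or out
   of the value, 2 and 3 list the facts in [c] about the sequence and about the order. *)
pose T t c x := match t with 0 => det true c x | 1 => det false c x
  | 2 => part true c x | _ => part false c x end.
pose Y : set nat := [set y | exists t c x, T t c x /\ y = npair t (npair c x)]%classic.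
have YE t c x : Y (npair t (npair c x)) <-> T t c x.
  split=> [[t' [c' [x' [h /npair_inj [-> /npair_inj [-> ->]]]]]] //|h].
  by exists t, c, x.
exists Y => M hM MY r hr Kr [MA MF].
set F := graph_code _ in MF; set A := ord_code _ in MA.
pose two := Plus One One; pose three := Plus One two.
(* Every fact that the oracle lists for the code under tag [t] holds in [X]. With the oracle, the
   sequence and the order as set variables 0, 1 and 2, [q] says that a code decides the bit and is
   correct for the given run. *)
pose test t X := All (Imp (Lt (Var 0) (tshift (Var 0)))
  (Imp (In (pair_term t (pair_term (Var 1) (Var 0))) 0) (In (Var 0) X))).
pose q t := And (In (pair_term t (pair_term (Var 0) (Var 1))) 0)
  (And (test two 1) (test three 2)).
have bq t : bounded (q t) by rewrite /q /test; repeat constructor.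
have S1 : Sigma01 (Ex (q Zero)) by exists (q Zero).
have P1 : Pi01 (All (Not (q One))) by exists (Not (q One)) => //; constructor.
pose E := scons Y (scons F (scons A (fun=> Y))).
have ME i : M (E i) by case: i => [|[|[|]]].
have qP b c x e : sat M (scons c (scons x e)) E (q (if b then Zero else One)) <->
    [/\ det b c x, forall i, i < c -> part true c i -> F i
      & forall i, i < c -> part false c i -> A i].
  have tE : forall e', teval e' (if b then Zero else One) = (~~ b : nat) by case: b.
  rewrite /q /test /= tE; split=> [[d [h h']]|[d h h']]; split.
  - by move/YE: d; case: b {tE}.
  - by move=> i ic /(YE 2) ?; apply: h.
  - by move=> i ic /(YE 3) ?; apply: h'.
  - by apply/YE; case: b d {tE}.
  - by split=> i ic; [move=> /(YE 2); apply: h|move=> /(YE 3); apply: h'].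
have sound b c x : [/\ det b c x, forall i, i < c -> part true c i -> F i
      & forall i, i < c -> part false c i -> A i] -> if b then G r x else ~ G r x.
  move=> [[r0 [n [h0 K0 -> d]]] hF hA]; apply: d => //.
  have lt i : i \in run_facts r0 n ++ order_facts r0 n -> i < code r0 n.
    by move=> ic; apply: (@facts_lt (run_facts r0 n, order_facts r0 n)).
  apply: facts_agree => // i ic; [apply: hF|apply: hA].
  - by apply: lt; rewrite mem_cat ic.
  - by exists (run_facts r0 n, order_facts r0 n).
  - by apply: lt; rewrite mem_cat ic orbT.
  - by exists (run_facts r0 n, order_facts r0 n).
have complete (b : bool) x : (if b then G r x else ~ G r x) -> exists c,
    [/\ det b c x, forall i, i < c -> part true c i -> F i
      & forall i, i < c -> part false c i -> A i].
  have [n hn] := cont r x hr Kr => Gx.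
  exists (code r n); split.
  - exists r, n; split=> // r' hr' Kr' rr'; have := hn r' hr' Kr' rr'.
    by case: b Gx; tauto.
  - by move=> i _ [s [/facts_code_inj <- /mapP [j _ ->]]]; exists j.
  - move=> i _ [s [/facts_code_inj <- /mapP [[x' y]]]].
    rewrite mem_filter => /andP[/= xy /allpairsP [[x2 y2] /= [xs ys [ex ey]]]] ->.
    rewrite ex ey in xy *; exists x2, y2.
    by split=> //; apply: (descent_support hr); [exact: xs|exact: ys].
(* The value has a Sigma form (some correct code forces the bit) and a Pi form (no correct code
   excludes it). *)
have [|X MX hX] := hM _ (ax_comprehension S1 P1) (fun=> 0) E ME.
  move=> x; split=> [[c hc] c' hc'|h].
    exact: (sound false c' x ((qP false _ _ _).1 hc') (sound true c x ((qP true _ _ _).1 hc))).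
  have Gx : G r x.
    apply: contrapT => nG; have [c hc] := complete false x nG.
    exact: (h c ((qP false c x _).2 hc)).
  by have [c hc] := complete true x Gx; exists c; apply/(qP true).
suff <- : X = G r by [].
apply/predeqP=> x; split.
  by move=> /(hX x).1 [c] /(qP true c x) => /(sound true).
move=> Gx; apply: (hX x).2; have [c hc] := complete true x Gx.
by exists c; apply/(qP true c x).
Qed.

Definition negligible (K : run -> Prop) : Prop :=
  exists Y : set nat, forall M, omega_model RCA0 M -> M Y ->
    forall r, descent r -> K r -> run_in M r -> ~ well_founded_in M id r.1.

Lemma entails_of_negligible : negligible (fun=> True) -> RCA0_entails_dilator D.
Proof.
move=> [Y hY]; exists Y => M hM _ MY A hA MA wfA [f [df Mf]].
exact: (hY M hM MY (A, f)).
Qed.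

Lemma negligible_sub (K K' : run -> Prop) :
  (forall r, descent r -> K r -> K' r) -> negligible K' -> negligible K.
Proof.
move=> sub [Y hY]; exists Y => M hM MY r hr Kr; exact: hY (sub r hr Kr).
Qed.

(** The oracles are joined as columns of a single one; [column_in] recovers each of them in every
    model. *)
Lemma negligible_bigcup (K : nat -> run -> Prop) :
  (forall i, negligible (K i)) -> negligible (fun r => exists i, K i r).
Proof.
move=> /choice [Z hZ].
exists [set y | exists i x, Z i x /\ y = npair i x]%classic => M hM MY r hr [i Kr].
apply: hZ Kr => //.
suff <- : [set x | [set y | exists i x, Z i x /\ y = npair i x]%classic (npair i x)]%classic
    = Z i by exact: column_in.
apply/predeqP=> x; split=> [[i' [x' [h /npair_inj [-> ->]]]] //|Zx].
by exists i, x.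
Qed.

Lemma negligibleU (K K' : run -> Prop) :
  negligible K -> negligible K' -> negligible (fun r => K r \/ K' r).
Proof.
move=> hK hK'; apply: (@negligible_sub _ (fun r => exists i, (if i is 0 then K else K') r)).
  by move=> r _ [Kr|Kr]; [exists 0|exists 1].
by apply: negligible_bigcup => -[|i].
Qed.

Section Descend.
Variables (K : run -> Prop) (rho : run -> nat -> nat) (n0 : nat).
Hypothesis rho_local : forall r r' n, descent r -> K r -> descent r' -> K r' ->
  n0 <= n -> agree r r' n.+1 -> rho r n = rho r' n.
Hypothesis rho_support : forall r n, descent r -> K r -> n0 <= n ->
  rho r n \in run_support r n.+1.

Definition below (r : run) a n :=
  [&& n0 <= n, a <= n & olt r.1 (rho r n) (rho r a)].

Definition next_below (r : run) a : nat :=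
  if pselect (exists n, below r a n) is left h then ex_minn h else n0.

Lemma next_belowP r a : (exists n, below r a n) ->
  below r a (next_below r a) /\ forall n, below r a n -> next_below r a <= n.
Proof.
by move=> h; rewrite /next_below; case: pselect => // h'; case: ex_minnP.
Qed.

Lemma below_agree r r' a n : descent r -> K r -> descent r' -> K r' ->
  n0 <= a -> agree r r' n.+1 -> below r a n = below r' a n.
Proof.
move=> hr Kr hr' Kr' na rr'; rewrite /below.
case: (leqP n0 n) => //= nn; case: (leqP a n) => //= an.
have ra : agree r r' a.+1 by apply: agree_le rr'.
rewrite -(rho_local hr Kr hr' Kr' nn rr') -(rho_local hr Kr hr' Kr' na ra).
have ns := rho_support hr Kr nn.
have as_ : rho r a \in run_support r n.+1.
  have /run_supportP [i ia xi] := rho_support hr Kr na.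
  by apply/run_supportP; exists i => //; exact: leq_trans ia _.
rewrite /olt (descent_support hr ns) (descent_support hr as_) (rr'.2 _ _ ns as_).
rewrite (agree_support rr') in ns as_.
by rewrite (descent_support hr' ns) (descent_support hr' as_).
Qed.

(** Otherwise, up to a negligible set of runs, every value of [rho] from [n0] on is undercut later.
    Passing each time to the least stage that undercuts the current value is continuous in the run,
    so an oracle puts the resulting descending sequence into the model, and these runs are
    negligible too. *)
Lemma descend : ~ negligible K -> exists2 n1, n0 <= n1 &
  ~ negligible (fun r => K r /\
      forall n, n1 <= n -> ~~ olt r.1 (rho r n) (rho r n1)).
Proof.
move=> nK; apply: contrapT => no; apply: nK.
pose K' r := K r /\ forall a, n0 <= a -> exists n, below r a n.
pose Kn n1 r := n0 <= n1 /\ (K r /\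
  forall n, n1 <= n -> ~~ olt r.1 (rho r n) (rho r n1)).
apply: (@negligible_sub _ (fun r => K' r \/ exists n1, Kn n1 r)).
  move=> r _ Kr; have [|nK'] := pselect (K' r); [by left|right].
  apply: contrapT => no'; apply: nK'; split=> // a na.
  apply: contrapT => nb; apply: no'; exists a; split=> //; split=> // n an.
  by apply/negP=> h; apply: nb; exists n; rewrite /below an h (leq_trans na an).
apply: negligibleU; last first.
  apply: negligible_bigcup => n1; have [n01|n01] := boolP (n0 <= n1).
    apply: contrapT => h; apply: no; exists n1 => // h'; apply: h.
    by apply: negligible_sub h' => r _ [].
  by exists (fun=> True) => M _ _ r _ [h]; rewrite h in n01.
pose ns r k := iter k (next_below r) n0.
pose g r k := rho r (ns r k).
have nsn r k : K' r -> n0 <= ns r k.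
  move=> Kr; elim: k => [|k IH] //=.
  by have [/and3P[]] := next_belowP (Kr.2 _ IH).
have nsP r k : K' r -> below r (ns r k) (ns r k.+1) /\
    forall n, below r (ns r k) n -> ns r k.+1 <= n.
  by move=> Kr; apply: next_belowP; apply: Kr.2; apply: nsn.
have ns_mono r k l : K' r -> k <= l -> ns r k <= ns r l.
  move=> Kr; elim: l => [|l IH]; first by rewrite leqn0 => /eqP ->.
  rewrite leq_eqVlt => /orP[/eqP -> //|/IH] h; apply: leq_trans h _.
  by have [/and3P[]] := nsP r l Kr.
have ns_agree r r' m k : descent r -> K' r -> descent r' -> K' r' ->
    agree r r' m -> ns r k < m -> ns r' k = ns r k.
  move=> hr Kr hr' Kr' rr'; elim: k => [|k IH] // km.
  have e : ns r' k = ns r k by apply: IH; apply: leq_ltn_trans km; apply: ns_mono.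
  have [b1 m1] := nsP r k Kr; have [b2 m2] := nsP r' k Kr'; rewrite e in b2 m2.
  have ba n : n < m -> below r (ns r k) n = below r' (ns r k) n.
    by move=> nm; apply: (below_agree hr Kr.1 hr' Kr'.1 (nsn _ _ Kr) (agree_le nm rr')).
  have le1 : ns r' k.+1 <= ns r k.+1 by apply: m2; rewrite -ba.
  by apply/eqP; rewrite eqn_leq le1 m1 // ba // (leq_ltn_trans le1).
have [|Y hY] := @continuous_in K' (fun r => graph_code (g r)).
  (* If the number [x] codes a pair [npair k y], then [k <= x]; hence the run up to the stage of the
     [x]-th value settles this bit of the graph. *)
  move=> r x hr Kr; exists (ns r x).+1 => r' hr' Kr' rr'.
  have e k : k <= x -> ns r' k = ns r k /\ g r' k = g r k.
    move=> kx; have km : ns r k < (ns r x).+1 by rewrite ltnS ns_mono.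
    have ek := ns_agree _ _ _ _ hr Kr hr' Kr' rr' km; split=> //.
    rewrite /g ek; apply/esym; apply: (rho_local hr Kr.1 hr' Kr'.1) => //; first exact: nsn.
    exact: agree_le rr'.
  have kx k y : x = npair k y -> k <= x by move=> ->; exact: leq_npairl.
  by split=> -[k ek]; exists k; have [_ gk] := e k (kx _ _ ek); rewrite {1}ek gk.
exists Y => M hM MY r hr Kr rM; apply.
exists (g r); split; last exact: (hY M hM MY r hr Kr rM).
by move=> k; have [/and3P[]] := nsP r k Kr.
Qed.

End Descend.

End Negligible.

(** * The order of [Dbar], multiples of omega, and the placement of arguments *)

Section DbarOrder.
Variables (D : predilator) (T : choiceType) (B : ord T) (x0 : T).
Hypothesis B_linear : linear_order B.

Lemma Dbar_refl p : p \in odom (Dbar B D) -> ole (Dbar B D) p p.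
Proof.
move=> /(img_of_mem B_linear x0) [tp ep ->].
have [N [u [v [hu hv uv vu [-> _]]]]] := Dbar_img_points B_linear tp tp ep ep.
apply: pt_mono => // i ik; rewrite uv //.
by have [r _ _ _] := B_linear; apply: r; apply: ep.1.
Qed.

Lemma Dbar_anti p q : p \in odom (Dbar B D) -> q \in odom (Dbar B D) ->
  ole (Dbar B D) p q -> ole (Dbar B D) q p -> p = q.
Proof.
move=> /(img_of_mem B_linear x0) [tp ep ->] /(img_of_mem B_linear x0) [tq eq ->].
move: ep eq; set g := nth x0 _; set g' := nth x0 _ => ep eq.
have [N [u [v [hu hv uv vu [-> ->]]]]] := Dbar_img_points B_linear tp tq ep eq.
move=> le1 le2.
have [kl sE e] := pt_inj tp tq hu hv (dle_anti (pt_in tp hu) (pt_in tq hv) le1 le2).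
rewrite /img sE -kl; congr pair.
have gg i : i < #|` p.2|%fset -> g i = g' i.
  move=> ik; have il : i < #|` q.2|%fset by rewrite -kl.
  have [_ a _ _] := B_linear; apply: a; rewrite ?ep.1 ?eq.1 //.
  by rewrite -uv // -vu // e // leqnn.
by apply/fsetP=> x; apply/imfsetP/imfsetP => -[i ik ->]; exists i;
  rewrite // gg //; move: ik; rewrite /= mem_iota.
Qed.

Lemma Dbar_trans p q r : p \in odom (Dbar B D) -> q \in odom (Dbar B D) ->
  r \in odom (Dbar B D) ->
  ole (Dbar B D) p q -> ole (Dbar B D) q r -> ole (Dbar B D) p r.
Proof.
move=> hp hq hr; have mem a : a \in odom (Dbar B D) -> all (odom B) a.2.
  by case: a => s a /and3P[].
have [|N [h [hN hle]]] := @linear_embedding _ _ B_linear (p.2 ++ q.2 ++ r.2)%SEQ.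
  by rewrite !all_cat !mem.
pose g (a : nat * {fset T}) := nth x0 (sort (ole B) a.2).
have H a : a \in odom (Dbar B D) -> {subset a.2 <= (p.2 ++ q.2 ++ r.2)%SEQ} ->
    [/\ trace D #|` a.2|%fset a.1, enumerates B #|` a.2|%fset (g a),
       a = img a.1 #|` a.2|%fset (g a),
       forall i, i < #|` a.2|%fset -> g a i \in (p.2 ++ q.2 ++ r.2)%SEQ &
       incr #|` a.2|%fset N (fun i => h (g a i))].
  move=> ha sub; have [ta ea eqa] := img_of_mem B_linear x0 ha.
  have gin i : i < #|` a.2|%fset -> g a i \in (p.2 ++ q.2 ++ r.2)%SEQ.
    by move=> ik; apply: sub; rewrite -(mem_sort (ole B)) mem_nth // size_sort.
  split=> //; split=> [i j ij jk|i /gin/hN //].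
  have ik := ltn_trans ij jk.
  by rewrite ltnNge hle ?gin // ea.2 // -ltnNge.
have sp : {subset p.2 <= (p.2 ++ q.2 ++ r.2)%SEQ} by move=> x; rewrite mem_cat => ->.
have sq : {subset q.2 <= (p.2 ++ q.2 ++ r.2)%SEQ}.
  by move=> x; rewrite !mem_cat => ->; rewrite orbT.
have sr : {subset r.2 <= (p.2 ++ q.2 ++ r.2)%SEQ}.
  by move=> x; rewrite !mem_cat => ->; rewrite !orbT.
have [tp ep pE ip up] := H p hp sp; have [tq eq qE iq uq] := H q hq sq.
have [tr er rE ir ur] := H r hr sr; rewrite pE qE rE.
have dl s t k l g g' := @Dbar_img_le D T B B_linear N s t k l g g' h.
rewrite !dl //; try by move=> i j ik jl; rewrite hle ?ip ?iq ?ir.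
by apply: dle_trans; apply: pt_in.
Qed.

Lemma Dbar_ltP p q : p \in odom (Dbar B D) -> q \in odom (Dbar B D) ->
  ole (Dbar B D) p q -> ~~ ole (Dbar B D) q p -> olt (Dbar B D) p q.
Proof.
move=> hp hq pq qp; rewrite /olt hp hq pq andbT /=.
by apply: contraNneq qp => <-; exact: Dbar_refl.
Qed.

End DbarOrder.

Lemma well_founded_no_descent (T : Type) (R : T -> T -> Prop) (f : nat -> T) :
  well_founded R -> ~ (forall n, R (f n.+1) (f n)).
Proof.
move=> wf h; suff H x : forall n, f n = x -> False by exact: (H (f 0) 0).
elim: (wf x) => {x} x _ IH n e; apply: (IH (f n.+1) _ n.+1) => //.
by rewrite -e.
Qed.

Section OmegaTimes.
Variables (T : eqType) (A : ord T).
Hypothesis A_linear : linear_order A.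

Lemma olt_trans : {in odom A & &, transitive (olt A)}.
Proof.
have [_ a t _] := A_linear => y x z hy hx hz /and4P[_ _ ne1 l1] /and4P[_ _ ne2 l2].
rewrite /olt hx hz (t y x z) // andbT /=; apply: contraNneq ne2 => xz.
by rewrite -xz in l2 *; apply/eqP; apply: a; rewrite // l2 l1.
Qed.

Lemma olt_asym x y : olt A x y -> olt A y x -> False.
Proof.
have [_ a _ _] := A_linear => /and4P[hx hy ne l1] /and4P[_ _ _ l2].
by move/eqP: ne; apply; apply: a; rewrite // l1 l2.
Qed.

Lemma olt_irr x : olt A x x = false.
Proof. by rewrite /olt eqxx !andbF. Qed.

Lemma olt_total x y : x \in odom A -> y \in odom A ->
  [|| olt A x y, x == y | olt A y x].
Proof.
have [_ _ _ t] := A_linear => hx hy; rewrite /olt hx hy eq_sym /=.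
by have /orP[->|->] := t _ _ hx hy; case: (y == x); rewrite ?orbT.
Qed.

Lemma omega_times_linear : linear_order (omega_times A).
Proof.
have tr := olt_trans; split.
- by move=> [x n] _ /=; rewrite eqxx leqnn orbT.
- move=> [x n] [y m] hx hy; rewrite /= => /andP[/orP[l1|/andP[/eqP e1 l1]] /orP[l2|/andP[/eqP e2 l2]]].
  + by case: (olt_asym l1 l2).
  + by rewrite e2 olt_irr in l1.
  + by rewrite e1 olt_irr in l2.
  + by rewrite /= in e1 l1 l2 *; rewrite e1; congr pair; lia.
- move=> [y m] [x n] [z p] hy hx hz; rewrite /= => /orP[l1|/andP[/eqP -> l1]] /orP[l2|/andP[/eqP e2 l2]].
  + by rewrite (tr y x z).
  + by rewrite -e2 l1.
  + by rewrite l2.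
  + by rewrite e2 eqxx (leq_trans l1) ?orbT.
- move=> [x n] [y m] /= hx hy; rewrite /=; have /or3P[->|/eqP e|->] := olt_total hx hy;
    rewrite ?orbT //; rewrite /= in e; rewrite e eqxx.
  by case/orP: (leq_total n m) => ->; rewrite ?orbT.
Qed.

End OmegaTimes.

Lemma one_plus_linear (T : Type) (A : ord T) : linear_order A -> linear_order (one_plus A).
Proof.
move=> [r a t l]; split.
- by move=> [x|] //= hx; apply: r.
- by move=> [x|] [y|] //= hx hy h; rewrite (a x y).
- by move=> [y|] [x|] [z|] //= hy hx hz; apply: t.
- by move=> [x|] [y|] //= hx hy; apply: l.
Qed.

Lemma omega_linear : linear_order omega.
Proof.
split=> [x _|x y _ _|x y z _ _ _|x y _ _]; [exact: leqnn|exact: anti_leq|exact: leq_trans|exact: leq_total].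
Qed.

Section Placement.
Variables (D : predilator) (T : choiceType) (A : ord T).
Hypothesis A_linear : linear_order A.

(** Priority arguments start the blocks of length omega indexed by [c], and each other argument
    follows in the block of the last priority argument to its left; [x.+1] keeps it off the start.
    Block [c 0] houses the arguments to the left of all priority arguments. *)
Definition place (c : nat -> T) j k s x : T * nat :=
  (c (prio_rank D j k s x),
   if x \in [seq prio D k s i | i <- iota 0 j] then 0 else x.+1).

Lemma place_prio c j k s i : i < j ->
  place c j k s (prio D k s i) = (c (prio_rank D j k s (prio D k s i)), 0).
Proof. by move=> ij; rewrite /place map_f ?mem_iota. Qed.

Lemma prio_rank_anchors j k s x : prio_rank D j k s x =
  rank [seq prio D k s i | i <- iota 0 j] x.
Proof. by rewrite /rank count_map. Qed.

Lemma place_enumerates c j k s : 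
  (forall a, a <= j -> c a \in odom A) ->
  (forall a b, a < b -> b <= j -> olt A (c a) (c b)) ->
  enumerates (omega_times A) k (place c j k s).
Proof.
move=> cA clt; have rj x : prio_rank D j k s x <= j.
  by rewrite -[leqRHS](size_iota 0 j); apply: count_size.
have lt x y : x < y ->
    ole (omega_times A) (place c j k s x) (place c j k s y) /\
    ~~ ole (omega_times A) (place c j k s y) (place c j k s x).
  move=> xy; rewrite /=.
  have := rank_le [seq prio D k s i | i <- iota 0 j] (ltnW xy).
  rewrite -!prio_rank_anchors leq_eqVlt => /orP[/eqP e|rxy].
    rewrite e olt_irr eqxx /=; case: (boolP (y \in _)) => yin; last by case: ifP => _; split=> //; lia.
    by have := rank_lt xy yin; rewrite -!prio_rank_anchors e ltnn.
  have h := clt _ _ rxy (rj y); rewrite h; split=> //.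
  apply/negP => /orP[/(olt_asym A_linear h) //|/andP[/eqP e _]].
  by rewrite e olt_irr in h.
split=> [i _|i i' _ _]; first by rewrite inE; exact/cA/rj.
case: (ltngtP i i') => [/lt[] //|/lt[_ /negbTE] //|<-].
by have [r _ _ _] := omega_times_linear A_linear; apply: r; rewrite inE; exact/cA/rj.
Qed.

End Placement.

Section SharedRank.
Variable D : predilator.

Lemma shared_prio_rank j k s l t N u v i : trace D k s -> trace D l t ->
  j <= k -> j <= l -> incr k N u -> incr l N v -> shared D j k s l t u v -> i < j ->
  prio_rank D j k s (prio D k s i) = prio_rank D j l t (prio D l t i).
Proof.
move=> ks lt jk jl hu hv suv ij.
rewrite -(rank_anchors ks jk hu) ?(prio_lt ks) ?(leq_trans ij) //.
by rewrite (shared_anchors suv) suv // (rank_anchors lt jl hv) ?(prio_lt lt) ?(leq_trans ij).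
Qed.

End SharedRank.

(** * Stabilization along descending runs *)

Section Stabilization.
Variable D : predilator.

Definition arity (r : run) m := #|` (r.2 m).2|%fset.
Definition shape (r : run) m := (r.2 m).1.
Definition argument (r : run) m := nth 0 (sort (ole r.1) (r.2 m).2).
Definition prio_arg (r : run) m i := argument r m (prio D (arity r m) (shape r m) i).

Lemma descent_trace r m : descent D r -> trace D (arity r m) (shape r m).
Proof. by move=> hr; have [] := img_of_mem hr.1 0 (descent_in m hr). Qed.

Lemma descent_lt r m m' : descent D r -> m < m' ->
  ole (Dbar r.1 D) (r.2 m') (r.2 m) /\ ~~ ole (Dbar r.1 D) (r.2 m) (r.2 m').
Proof.
move=> hr; have hin n := descent_in n hr; have tr := Dbar_trans 0 hr.1.
elim: m' => // m' IH; have /and4P[_ _ ne le] := hr.2 m'.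
have nle : ~~ ole (Dbar r.1 D) (r.2 m') (r.2 m'.+1).
  by apply: contraNN ne => h; apply/eqP; apply: (Dbar_anti 0 hr.1).
rewrite ltnS leq_eqVlt => /orP[/eqP -> //|/IH [le' nle']].
split; first exact: tr le le'.
by apply: contraNN nle => h; apply: tr le' h.
Qed.

Lemma descent_points r m m' : descent D r -> m < m' -> exists N u v,
  [/\ incr (arity r m) N u, incr (arity r m') N v,
    forall i j, i < arity r m -> j < arity r m' ->
      (u i <= v j) = ole r.1 (argument r m i) (argument r m' j),
    forall i j, i < arity r m -> j < arity r m' ->
      (v j <= u i) = ole r.1 (argument r m' j) (argument r m i) &
    dlt D N (pt D N (arity r m') (shape r m') v) (pt D N (arity r m) (shape r m) u)].
Proof.
move=> hr mm'; have [_ lt] := descent_lt hr mm'.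
have [t1 e1 q1] := img_of_mem hr.1 0 (descent_in m hr).
have [t2 e2 q2] := img_of_mem hr.1 0 (descent_in m' hr).
have [N [u [v [hu hv uv vu [le _]]]]] := Dbar_img_points hr.1 t1 t2 e1 e2.
exists N, u, v; split=> //.
by rewrite /dlt -le -q1 -q2.
Qed.

Lemma argument_in r m i : descent D r -> i < arity r m -> argument r m i \in (r.2 m).2.
Proof. by move=> hr im; rewrite -(mem_sort (ole r.1)) mem_nth // size_sort. Qed.

Lemma argument_odom r m i : descent D r -> i < arity r m -> argument r m i \in odom r.1.
Proof.
by move=> hr im; have [_ [h _] _] := img_of_mem hr.1 0 (descent_in m hr); apply: h.
Qed.

Lemma shared_of_args r m m' j u v : descent D r ->
  j <= arity r m -> j <= arity r m' ->
  (forall i j, i < arity r m -> j < arity r m' ->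
      (u i <= v j) = ole r.1 (argument r m i) (argument r m' j)) ->
  (forall i j, i < arity r m -> j < arity r m' ->
      (v j <= u i) = ole r.1 (argument r m' j) (argument r m i)) ->
  (forall i, i < j -> prio_arg r m i = prio_arg r m' i) ->
  shared D j (arity r m) (shape r m) (arity r m') (shape r m') u v.
Proof.
move=> hr jm jm' uv vu e i ij; have := e i ij; rewrite /prio_arg => ei.
have t1 := descent_trace m hr; have t2 := descent_trace m' hr.
have p1 := prio_lt t1 (leq_trans ij jm); have p2 := prio_lt t2 (leq_trans ij jm').
apply/eqP; rewrite eqn_leq uv // vu // ei.
by have [re _ _ _] := hr.1; rewrite re // argument_odom.
Qed.

Lemma run_dominated_or_link r j m m' : descent D r -> m < m' ->
  j <= arity r m -> j <= arity r m' ->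
  (forall i, i < j -> prio_arg r m i = prio_arg r m' i) ->
  dominated D j (arity r m) (shape r m) (arity r m') (shape r m') \/
  link D j (arity r m) (shape r m) (arity r m') (shape r m').
Proof.
move=> hr mm' jm jm' e; have [N [u [v [hu hv uv vu lt]]]] := descent_points hr mm'.
have s := shared_of_args hr jm jm' uv vu e.
exact: (dominated_or_link (descent_trace m hr) (descent_trace m' hr) jm jm' hu hv s lt).
Qed.

Hypothesis D_omega2_wf : well_founded_order (Dbar omega_squared D).

(* Replacing the arguments beyond the first [j] priorities by natural numbers
   above them embeds the run into [omega * (1 + j)]. *)
Lemma no_dominated_chain r j (c : nat -> nat) : descent D r ->
  (forall a, c a < c a.+1) ->
  (forall a, j <= arity r (c a)) ->
  (forall a i, i < j -> prio_arg r (c a) i = prio_arg r (c a.+1) i) ->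
  ~ (forall a, dominated D j (arity r (c a)) (shape r (c a))
                 (arity r (c a.+1)) (shape r (c a.+1))).
Proof.
move=> hr cc jc ec dom.
have lin : linear_order omega_squared by exact: omega_times_linear omega_linear.
pose g a := place D id j (arity r (c a)) (shape r (c a)).
have en a : enumerates omega_squared (arity r (c a)) (g a).
  apply: (place_enumerates D omega_linear) => // x y xy _.
  by rewrite /olt /= ltn_neqAle in xy *.
pose q a := img (shape r (c a)) (arity r (c a)) (g a).
have tr a := descent_trace (c a) hr.
have qin a : q a \in odom (Dbar omega_squared D) by exact: img_in.
apply: (@well_founded_no_descent _ _ q D_omega2_wf) => a.
have [N [u [v [hu hv uv vu [le ge]]]]] := Dbar_img_points lin (tr a) (tr a.+1) (en a) (en a.+1).
have s : shared D j (arity r (c a)) (shape r (c a)) (arity r (c a.+1)) (shape r (c a.+1)) u v.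
  move=> i ij; have [N' [u' [v' [hu' hv' uv' vu' _]]]] := descent_points hr (cc a).
  have s' := shared_of_args hr (jc a) (jc a.+1) uv' vu' (ec a).
  have e := shared_prio_rank (tr a) (tr a.+1) (jc a) (jc a.+1) hu' hv' s' ij.
  have p1 := prio_lt (tr a) (leq_trans ij (jc a)).
  have p2 := prio_lt (tr a.+1) (leq_trans ij (jc a.+1)).
  apply/eqP; rewrite eqn_leq uv // vu // /g !place_prio // e.
  by have [re _ _ _] := lin; rewrite re.
have lt := dom a N u v hu hv s.
apply: (Dbar_ltP (0, 0) lin) => //.
  by rewrite /q ge; apply: dltW lt; apply: pt_in.
by rewrite /q le.
Qed.

(* [x] records an index from which on the [i]-th priority has stabilized, and
   the arity and shape of the term at this index. *)
Definition stable i (x : nat * (nat * nat)) (r : run) : Prop :=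
  [/\ arity r x.1 = x.2.1, shape r x.1 = x.2.2,
      forall m, x.1 <= m -> i < arity r m /\ prio_arg r m i = prio_arg r x.1 i &
      forall m m', x.1 <= m -> m < m' ->
        link D i (arity r m) (shape r m) (arity r m') (shape r m')].

Definition stage (h : seq (nat * (nat * nat))) (r : run) : Prop :=
  forall i, i < size h -> stable i (nth (0, (0, 0)) h i) r /\
    forall i', i < i' -> i' < size h ->
      (nth (0, (0, 0)) h i).1 < (nth (0, (0, 0)) h i').1.

Lemma ev_linked h r n0 : descent D r -> stage h r ->
  (forall i, i < size h -> (nth (0, (0, 0)) h i).1 <= n0) ->
  exists2 n, n0 <= n & forall m, n < m ->
    link D (size h) (arity r n) (shape r n) (arity r m) (shape r m).
Proof.
move=> hr st hn; apply: contrapT => no.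
have jm m : n0 <= m -> size h <= arity r m.
  move=> nm; case E : (size h) => [//|j].
  have jh : j < size h by rewrite E.
  have [[_ _ /(_ m) []] //] := st j jh.
  exact: leq_trans (hn j jh) nm.
have em i m m' : i < size h -> n0 <= m -> n0 <= m' -> prio_arg r m i = prio_arg r m' i.
  move=> ih nm nm'; have [[_ _ c _] _] := st i ih.
  by rewrite (c m _).2 ?(c m' _).2 // (leq_trans (hn i ih)).
have /choice [f hf] : forall n, exists m, n0 <= n -> n < m /\
    dominated D (size h) (arity r n) (shape r n) (arity r m) (shape r m).
  move=> n; have [nn|nn] := boolP (n0 <= n); last by exists 0.
  apply: contrapT => no'; apply: no; exists n => // m nm.
  have nm' : n0 <= m by exact: leq_trans nn (ltnW nm).
  have [d|//] := run_dominated_or_link hr nm (jm _ nn) (jm _ nm')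
    (fun i ih => em i n m ih nn nm').
  by case: no'; exists m.
pose c a := iter a f n0.
have cn a : n0 <= c a.
  by elim: a => //= a IH; apply: leq_trans IH (ltnW (hf _ IH).1).
apply: (@no_dominated_chain r (size h) c hr) => [a|a|a i ih|a].
- exact: (hf _ (cn a)).1.
- exact: jm.
- exact: em.
- exact: (hf _ (cn a)).2.
Qed.

Lemma sort_agree r r' n : descent D r -> descent D r' -> agree r r' n.+1 ->
  sort (ole r.1) (r.2 n).2 = sort (ole r'.1) (r'.2 n).2.
Proof.
move=> hr hr' [e le]; rewrite -e //.
have a_in x : x \in (r.2 n).2 -> x \in run_support r n.+1.
  by move=> xa; apply/run_supportP; exists n.
have o1 : all (odom r.1) (r.2 n).2.
  by have := descent_in n hr; case: (r.2 n) => s a /and3P[].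
have o2 : all (odom r'.1) (r.2 n).2.
  by rewrite e //; have := descent_in n hr'; case: (r'.2 n) => s a /and3P[].
apply: (sort_odom_eq hr.1 o1); last by rewrite perm_sym perm_sort.
rewrite (@eq_in_sorted _ (mem (r.2 n).2) _ (ole r'.1)).
- exact: (sort_odom_sorted hr'.1 o2).
- by move=> x y xa ya; apply: le; apply: a_in.
- by apply/allP=> x; rewrite mem_sort.
Qed.

(** The set of runs is shrunk three times: to fix a term linked to all later ones, to make the
    [j]-th priority argument at some [n1] never undercut later ([descend]), and to fix arity and
    shape at [n1]. This argument is then constant from [n1] on. *)
Lemma stage_step h : ~ negligible D (stage h) ->
  exists x, ~ negligible D (stage (rcons h x)).
Proof.
move=> nh; set j := size h.
pose n0 := (sumn (map fst h)).+1.
have hn i : i < j -> (nth (0, (0, 0)) h i).1 < n0.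
  rewrite /j /n0 ltnS; elim: h i {nh j n0} => // y h IH [|i] /=; first by rewrite leq_addr.
  by rewrite ltnS => /IH /leq_trans; apply; rewrite leq_addl.
pose K1 n r := stage h r /\ forall m, n < m ->
  link D j (arity r n) (shape r n) (arity r m) (shape r m).
have [n nn K1n] : exists2 n, n0 <= n & ~ negligible D (K1 n).
  apply: contrapT => no; apply: nh.
  apply: (@negligible_sub _ _ (fun r => exists n, n0 <= n /\ K1 n r)).
    move=> r hr st; have [n nn ln] := ev_linked hr st (fun i ih => ltnW (hn i ih)).
    by exists n.
  apply: negligible_bigcup => n; have [nn|nn] := boolP (n0 <= n).
    apply: contrapT => h'; apply: no; exists n => // neg; apply: h'.
    by apply: negligible_sub neg => r _ [].
  by exists (fun=> True) => M _ _ r _ [].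
have prio_in r m : descent D r -> K1 n r -> n < m -> j < arity r m.
  by move=> hr [_ ln] nm; have [] := ln m nm.
have [||n1 nn1 K2] := @descend D (K1 n) (fun r m => prio_arg r m j) n.+1 _ _ K1n.
- move=> r r' m hr Kr hr' Kr' nm rr'.
  have e : r.2 m = r'.2 m by apply: rr'.1.
  by rewrite /prio_arg /argument /arity /shape (sort_agree hr hr' rr') e.
- move=> r m hr Kr nm; apply/run_supportP; exists m => //.
  apply: argument_in => //; apply: prio_lt; first exact: descent_trace.
  exact: prio_in.
pose K3 p r := (K1 n r /\ (forall m, n1 <= m ->
     ~~ olt r.1 (prio_arg r m j) (prio_arg r n1 j))) /\
  (arity r n1 = p.1 /\ shape r n1 = p.2).
have [k [s K3ks]] : exists k s, ~ negligible D (K3 (k, s)).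
  apply: contrapT => no; apply: K2.
  apply: (@negligible_sub _ _ (fun r => exists k s, K3 (k, s) r)).
    by move=> r _ h'; exists (arity r n1), (shape r n1).
  apply: negligible_bigcup => k; apply: negligible_bigcup => s.
  by apply: contrapT => h'; apply: no; exists k, s.
exists (n1, (k, s)) => neg; apply: K3ks; apply: negligible_sub neg.
move=> r hr [[[st ln] mn] [/= ak as_]] i.
rewrite size_rcons ltnS leq_eqVlt => /orP[/eqP ->|ij]; last first.
  have [st_i inc] := st i ij; rewrite nth_rcons ij; split=> // i' ii'; rewrite nth_rcons.
  rewrite ltnS leq_eqVlt => /orP[/eqP ->|i'j].
    by rewrite ltnn eqxx /=; apply: leq_trans (hn i ij) _; lia.
  by rewrite i'j; apply: inc.
rewrite nth_rcons ltnn eqxx; split; last by lia.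
have lk m m' : n1 <= m -> m < m' -> link D j (arity r m) (shape r m) (arity r m') (shape r m').
  move=> nm mm'; apply: link_trans (ln m _) (ln m' _); try exact: descent_trace; lia.
have jar m : n1 <= m -> j < arity r m by move=> nm; apply: (prio_in r) => //; lia.
split=> //= m; rewrite leq_eqVlt => /orP[/eqP <-|n1m]; first by split=> //; apply: jar.
split; first by apply: jar; apply: ltnW.
have [N [u [v [hu hv uv vu lt]]]] := descent_points hr n1m.
have j1 := jar n1 (leqnn _); have jm := jar m (ltnW n1m).
have eqs i' : i' < j -> prio_arg r n1 i' = prio_arg r m i'.
  move=> ij; have [[_ _ c _] _] := st i' ij; have := hn i' ij => hni.
  by rewrite (c m _).2 ?(c n1 _).2 //; lia.
have sh := shared_of_args hr (ltnW j1) (ltnW jm) uv vu eqs.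
have [_ _ _ /(_ N u v hu hv sh) [up _]] := lk n1 m (leqnn _) n1m.
have p1 := prio_lt (descent_trace n1 hr) j1; have p2 := prio_lt (descent_trace m hr) jm.
have [_ anti _ _] := hr.1.
(* As the earlier priority arguments are shared, an increase would raise the value by the link,
   against descent; a strict decrease is excluded by the choice of [n1]. *)
have le1 : ole r.1 (prio_arg r m j) (prio_arg r n1 j).
  rewrite -vu //; case: leqP => // /up lt'.
  by have := dltW (pt_in (descent_trace m hr) hv) (pt_in (descent_trace n1 hr) hu) lt;
    rewrite -[dle _ _ _ _]negbK -/(dlt _ _ _ _) lt'.
have o1 : prio_arg r n1 j \in odom r.1 by exact: argument_odom.
have o2 : prio_arg r m j \in odom r.1 by exact: argument_odom.
apply/eqP; apply: contraNT (mn m (ltnW n1m)) => ne.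
by rewrite /olt o1 o2 ne le1.
Qed.

End Stabilization.

Lemma not_negligible_ex D K : ~ negligible D K -> exists r, descent D r /\ K r.
Proof.
move=> nK; apply: contrapT => no; apply: nK; exists (fun=> True) => M _ _ r hr Kr.
by case: no; exists r.
Qed.

Definition linked_family (D : predilator) (k s : nat -> nat) : Prop :=
  [/\ forall n, trace D (k n) (s n), forall n, n < k n &
      forall i n n', i <= n -> n < n' -> link D i (k n) (s n) (k n') (s n')].

(** Each finite part of the infinite history is realized by a run of its own, since its stage is not
    negligible; this is enough because every required property concerns at most two terms. *)
Lemma exists_linked_family D : well_founded_order (Dbar omega_squared D) ->
  ~ RCA0_entails_dilator D -> exists k s, linked_family D k s.
Proof.
move=> wf nD; pose x0 := (0, (0, 0)).
have /choice [f hf] : forall h, exists x, ~ negligible D (stage D h) ->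
    ~ negligible D (stage D (rcons h x)).
  move=> h; have [neg|nh] := pselect (negligible D (stage D h)); first by exists x0.
  by have [x hx] := stage_step wf nh; exists x.
pose hs n := iter n (fun h => rcons h (f h)) [::].
have hs_size n : size (hs n) = n by elim: n => //= n IH; rewrite size_rcons IH.
have hs_neg n : ~ negligible D (stage D (hs n)).
  elim: n => [neg|n IH]; last exact: hf.
  by apply: nD; apply: entails_of_negligible; apply: negligible_sub neg => r _ _ [].
pose x n := nth x0 (hs n.+1) n.
have hs_nth i n : i < n -> nth x0 (hs n) i = x i.
  elim: n => // n IH; rewrite ltnS leq_eqVlt => /orP[/eqP -> //|i_n].
  by rewrite [hs _]/= nth_rcons hs_size i_n IH.
have ex n : exists r, [/\ descent D r, forall i, i < n -> stable D i (x i) r &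
    forall i i', i < i' -> i' < n -> (x i).1 < (x i').1].
  have [r [hr st]] := not_negligible_ex (hs_neg n); exists r; split=> // [i i_n|i i' ii' i'n].
    by have := (st i); rewrite hs_size hs_nth // => /(_ i_n) [].
  have i_n := ltn_trans ii' i'n.
  by have := (st i); rewrite hs_size => /(_ i_n) [_ /(_ i' ii' i'n)]; rewrite !hs_nth.
exists (fun n => (x n).2.1), (fun n => (x n).2.2); split=> [n|n|i n n' i_n nn'].
- have [r [hr st _]] := ex n.+1; have [<- <- _ _] := st n (leqnn _).
  exact: descent_trace.
- have [r [hr st _]] := ex n.+1; have [<- _ h _] := st n (leqnn _).
  by have [] := h (x n).1 (leqnn _).
- have [r [hr st inc]] := ex n'.+1.
  have nl : n < n'.+1 by exact: leqW.
  have [<- <- _ _] := st n nl.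
  have [<- <- _ _] := st n' (leqnn _).
  have [_ _ _ lk] := st i (leq_ltn_trans i_n nl).
  apply: lk; last by apply: inc.
  by move: i_n; rewrite leq_eqVlt => /orP[/eqP -> //|i_n]; apply/ltnW/inc => //; lia.
Qed.

(** * The thread *)

Section Thread.
Variables (D : predilator) (k s : nat -> nat).
Hypothesis family : linked_family D k s.

Let pr n i := prio D (k n) (s n) i.

(** Term number [maxn i i'] is the first one in which both priorities are controlled by the links;
    by [thread_orderE] all later terms give the same comparison. *)
Definition thread_order : rel nat := fun i i' => pr (maxn i i') i <= pr (maxn i i') i'.

Lemma family_trace n : trace D (k n) (s n). Proof. by case: family. Qed.
Lemma family_arity n : n < k n. Proof. by case: family. Qed.
Lemma family_link i n n' : i <= n -> n < n' -> link D i (k n) (s n) (k n') (s n').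
Proof. by case: family => _ _; apply. Qed.

Lemma family_lt n i : i <= n -> pr n i < k n.
Proof.
move=> i_n; apply: prio_lt; first exact: family_trace.
exact: leq_ltn_trans i_n (family_arity n).
Qed.

Lemma thread_orderE n i i' : i <= n -> i' <= n -> thread_order i i' = (pr n i <= pr n i').
Proof.
move=> i_n i'n; rewrite /thread_order; set m := maxn i i'.
have im : i <= m by rewrite leq_maxl.
have i'm : i' <= m by rewrite leq_maxr.
have : m <= n by rewrite geq_max i_n.
rewrite leq_eqVlt => /orP[/eqP -> //|mn].
by have [_ _ -> //] := family_link (leqnn m) mn.
Qed.

Lemma thread_order_linear : linear_order (Ord predT thread_order).
Proof.
split=> [i _|i i' _ _|i' i i'' _ _ _|i i' _ _]; rewrite /=.
- by rewrite /thread_order.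
- have h := leq_maxl i i'; have h' := leq_maxr i i'.
  rewrite !(@thread_orderE (maxn i i')) // -eqn_leq => /eqP.
  by apply: (prio_inj (family_trace _)); apply: leq_ltn_trans (family_arity _).
- pose n := maxn i (maxn i' i''); have h1 : i <= n by rewrite /n; lia.
  have h2 : i' <= n by rewrite /n; lia.
  have h3 : i'' <= n by rewrite /n; lia.
  by rewrite !(@thread_orderE n) //; apply: leq_trans.
- have h := leq_maxl i i'; have h' := leq_maxr i i'.
  by rewrite !(@thread_orderE (maxn i i')) // leq_total.
Qed.

Let L := thread_order.
Let pos n i := perm_of L n i.

Lemma iota_odom n : all (odom (Ord predT L)) (iota 0 n).
Proof. by apply/allP. Qed.

Lemma pos_lt n i : i < n -> pos n i < n.
Proof.
move=> i_n; rewrite /pos /perm_of -[X in _ < X](size_iota 0 n) -(size_sort L).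
by rewrite index_mem mem_sort mem_iota.
Qed.

Lemma pos_leE n i i' : i < n -> i' < n -> (pos n i <= pos n i') = L i i'.
Proof.
move=> i_n i'n.
by apply: (index_sort thread_order_linear (iota_odom n)); rewrite mem_iota.
Qed.

Lemma pos_surj n a : a < n -> exists2 i, i < n & pos n i = a.
Proof.
move=> an; have h : a < size (sort L (iota 0 n)) by rewrite size_sort size_iota.
exists (nth 0 (sort L (iota 0 n)) a); last by rewrite /pos /perm_of index_uniq // sort_uniq iota_uniq.
have : nth 0 (sort L (iota 0 n)) a \in iota 0 n by rewrite -(mem_sort L) mem_nth.
by rewrite mem_iota.
Qed.

(** The rank counts the position itself, hence the successor; [row] absorbs it by letting entry 0 be
    the new least element. *)
Lemma prio_rank_pos n i : i < n ->
  prio_rank D n (k n) (s n) (pr n i) = (pos n i).+1.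
Proof.
move=> i_n; pose S := sort L (iota 0 n).
have pSi : perm_eq S (iota 0 n) by rewrite perm_sort.
have -> : prio_rank D n (k n) (s n) (pr n i) = count (fun i' => pos n i' <= pos n i) (iota 0 n).
  apply: eq_in_count => i'; rewrite mem_iota => /= i'n.
  by rewrite pos_leE // /L (@thread_orderE n) // ltnW.
rewrite -(permP pSi) -[S in count _ S](mkseq_nth 0) /mkseq count_map.
have sS : size S = n by rewrite size_sort size_iota.
have pn := pos_lt i_n.
rewrite sS (@eq_in_count _ _ (fun a => a <= pos n i)); last first.
  move=> a; rewrite mem_iota => /= an.
  by rewrite [pos n (nth _ _ _)]/pos /perm_of index_uniq // ?sS // sort_uniq iota_uniq.
rewrite -{2}(subnKC pn) iotaD count_cat add0n.
rewrite (@eq_in_count _ _ predT) => [|a]; last by rewrite mem_iota ltnS => /andP[_ ->].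
rewrite count_predT size_iota (@eq_in_count _ _ pred0) => [|a].
  by rewrite count_pred0 addn0.
by rewrite mem_iota => /andP[/ltn_geF ->].
Qed.

Definition row (t : seq nat) r : option nat :=
  if r is r'.+1 then Some (nth 0 t r') else None.

Definition spread (t : seq nat) := place D (row t) (size t) (k (size t)) (s (size t)).

Definition eta_map (A : ord nat) (t : seq nat) : nat * {fset option nat * nat} :=
  img (s (size t)) (k (size t)) (spread t).

Section Order.
Variable A : ord nat.
Hypothesis A_linear : linear_order A.
Let B_linear : linear_order (omega_one_plus A) :=
  omega_times_linear (one_plus_linear A_linear).

Lemma row_lt t a b : t \in odom (D_order L A) -> a < b -> b <= size t ->
  olt (one_plus A) (row t a) (row t b).
Proof.
move=> /andP[to ts]; case: b => // b ab bt.
have bo : nth 0 t b \in odom A by exact: (allP to) (mem_nth _ _).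
case: a ab => [|a] ab; first by rewrite /olt /= !inE bo.
have := sorted_ltn_nth_in (olt_trans A_linear) 0 to ts.
move=> /(_ a b (ltn_trans (ab : a < b) bt) bt ab) /and4P[h1 h2 h3 h4].
by rewrite /olt /= !inE h1 h2 h4 /= andbT; apply: contraNneq h3 => -[->].
Qed.

Lemma row_in t a : t \in odom (D_order L A) -> a <= size t ->
  row t a \in odom (one_plus A).
Proof.
move=> /andP[to _]; case: a => // a at_.
exact: (allP to) (mem_nth _ _).
Qed.

Lemma spread_enumerates t : t \in odom (D_order L A) ->
  enumerates (omega_one_plus A) (k (size t)) (spread t).
Proof.
move=> ht; apply: place_enumerates; first exact: one_plus_linear.
  by move=> a; apply: row_in.
by move=> a b; apply: row_lt.
Qed.

Lemma spread_prio t i : i < size t ->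
  spread t (pr (size t) i) = (Some (perm_entry L t i), 0).
Proof. by move=> it; rewrite /spread /pr place_prio // prio_rank_pos. Qed.

Lemma eta_in t : t \in odom (D_order L A) ->
  eta_map A t \in odom (Dbar (omega_one_plus A) D).
Proof.
move=> ht; apply: (img_in B_linear); first exact: family_trace.
exact: spread_enumerates.
Qed.

(** At a first difference [j] the earlier priority arguments are shared, and [family_link] decides,
    or [prio_wins] if the lengths agree. If [t] is exhausted first, the argument of priority
    [size t] decides, which is a filler in [t] and an entry in [t']. *)
Lemma eta_lt t t' : t \in odom (D_order L A) -> t' \in odom (D_order L A) ->
  D_lt L A t t' ->
  ole (Dbar (omega_one_plus A) D) (eta_map A t) (eta_map A t') /\
  ~~ ole (Dbar (omega_one_plus A) D) (eta_map A t') (eta_map A t).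
Proof.
move=> ht ht'; have e := spread_enumerates ht; have e' := spread_enumerates ht'.
have tr := family_trace (size t); have tr' := family_trace (size t').
have [N [u [v [hu hv uv vu [le ge]]]]] := Dbar_img_points B_linear tr tr' e e'.
rewrite /eta_map le ge => h.
suff lt : dlt D N (pt D N (k (size t)) (s (size t)) u) (pt D N (k (size t')) (s (size t')) v).
  by split=> //; apply: dltW lt; apply: pt_in.
have plt n i : i < n -> pr n i < k n by move=> /ltnW/family_lt.
have eqs i : i < size t -> i < size t' -> perm_entry L t i = perm_entry L t' i ->
    u (pr (size t) i) = v (pr (size t') i).
  move=> it it' ei; apply/eqP; rewrite eqn_leq uv ?plt // vu ?plt // !spread_prio // ei.
  by rewrite /= eqxx leqnn orbT.
case/orP: h => [/existsP [[j /=]]|/andP[tt' /forallP eq_t]].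
  rewrite leq_min => /andP[jt jt'] /andP[lt_j /forallP eq_j].
  have sh : shared D j (k (size t)) (s (size t)) (k (size t')) (s (size t')) u v.
    move=> i ij; apply: eqs; try exact: ltn_trans ij _.
    exact: (eqP (eq_j (Ordinal ij))).
  have lt_uv : u (pr (size t) j) < v (pr (size t') j).
    rewrite ltnNge vu ?plt // !spread_prio //=; apply/negP.
    have [lo1 lo2 lo3 lo4] := and4P lt_j.
    move=> /orP[/and4P[_ _ _ /= h]|/andP[/eqP [h] _]].
      by apply: (olt_asym A_linear lt_j); rewrite /olt lo1 lo2 eq_sym lo3 h.
    by rewrite h eqxx in lo3.
  case: (ltngtP (size t) (size t')) => [tt'|tt'|tt'].
  - have [_ _ _ /(_ N u v hu hv sh) [h _]] := family_link (ltnW jt) tt'.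
    exact: h.
  - have [_ _ _ /(_ N v u hv hu (sharedC sh)) [_ h]] := family_link (ltnW jt') tt'.
    exact: h.
  - move: hu hv lt_uv sh; rewrite -tt' => hu hv lt_uv sh.
    apply: (prio_wins (i := j)) => //.
    exact: ltn_trans jt (family_arity _).
have sh : shared D (size t) (k (size t)) (s (size t)) (k (size t')) (s (size t')) u v.
  move=> i it; apply: eqs => //; first exact: ltn_trans it tt'.
  exact: (eqP (eq_t (Ordinal it))).
have [_ _ pat /(_ N u v hu hv sh) [h _]] := family_link (leqnn (size t)) tt'.
have ki := family_lt (leqnn (size t)); have ki' := plt _ _ tt'.
apply: h; rewrite ltnNge (vu _ _ ki ki').
rewrite spread_prio // /spread /place.
have -> : (prio D (k (size t)) (s (size t)) (size t)
    \in [seq prio D (k (size t)) (s (size t)) i | i <- iota 0 (size t)]) = false.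
  apply/negbTE/negP => /mapP [i]; rewrite mem_iota => /= it e_i.
  have := prio_inj tr (family_arity _) (ltn_trans it (family_arity _)) e_i.
  by move=> ti; rewrite ti ltnn in it.
set r := prio_rank _ _ _ _ _.
have rt : r <= size t by rewrite -[leqRHS](size_iota 0 (size t)); apply: count_size.
(* The filler lies in the least block or in that of the last entry to its left. By the common
   pattern this entry is also to the left of the new entry of [t'], which therefore starts a
   strictly higher block. *)
case E : r rt => [|a] at_; first by rewrite /= /olt /= !andbF.
have [i it pia] := pos_surj at_.
have it' := ltn_trans it tt'.
have pi_t : pr (size t) i <= pr (size t) (size t).
  rewrite leqNgt; apply/negP => lt_i.
  have : prio D (k (size t)) (s (size t)) i \in [seq prio D (k (size t)) (s (size t)) i | i <- iota 0 (size t)].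
    by rewrite map_f ?mem_iota.
  move=> /(rank_lt lt_i); rewrite -!prio_rank_anchors -/r E.
  by rewrite (prio_rank_pos it) pia ltnn.
have pi_t' : pr (size t') i < pr (size t') (size t).
  rewrite ltn_neqAle andbC /pr -(pat _ _ (ltnW it) (leqnn _)) pi_t /=.
  apply/eqP => /(prio_inj tr' (ltn_trans it' (family_arity _)) (ltn_trans tt' (family_arity _))) ti.
  by rewrite ti ltnn in it.
have [_ m] := e'.
have nle : ~~ ole (omega_one_plus A) (spread t' (pr (size t') (size t))) (spread t' (pr (size t') i)).
  by rewrite m ?plt // -ltnNge.
rewrite !spread_prio // in nle.
have ent : nth 0 t a = perm_entry L t' i.
  by rewrite -(eqP (eq_t (Ordinal it))) /perm_entry /= -pia.
rewrite /= ent; move: nle; rewrite /= leqnn andbT negb_or => /andP[n1 n2].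
by rewrite n1 n2.
Qed.

Lemma D_order_total t t' : t \in odom (D_order L A) -> t' \in odom (D_order L A) ->
  t != t' -> D_lt L A t t' || D_lt L A t' t.
Proof.
move=> ht ht' ne.
have entry_in r i : r \in odom (D_order L A) -> i < size r -> perm_entry L r i \in odom A.
  by move=> /andP[ro _] ir; apply: (allP ro); apply/mem_nth/pos_lt.
pose differ j := [&& j < size t, j < size t' & perm_entry L t j != perm_entry L t' j].
have [ex|nex] := pselect (exists j, differ j).
  case: (ex_minnP ex) => j /and3P[jt jt' dj] mj.
  have eqj i : i < j -> perm_entry L t i = perm_entry L t' i.
    move=> ij; apply: contrapT => /eqP d; have := mj i.
    by rewrite /differ d (ltn_trans ij jt) (ltn_trans ij jt') leqNgt ij => /(_ isT).
  have jm : j < minn (size t) (size t') by rewrite leq_min jt.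
  have jm' : j < minn (size t') (size t) by rewrite leq_min jt'.
  have := olt_total A_linear (entry_in _ _ ht jt) (entry_in _ _ ht' jt').
  rewrite (negbTE dj) /= => /orP[lt|lt]; apply/orP; [left|right]; apply/orP; left.
    apply/existsP; exists (Ordinal jm); rewrite /= lt /=.
    by apply/forallP=> -[i ij]; apply/eqP/eqj.
  apply/existsP; exists (Ordinal jm'); rewrite /= lt /=.
  by apply/forallP=> -[i ij]; apply/eqP/esym/eqj.
have eqi i : i < size t -> i < size t' -> perm_entry L t i = perm_entry L t' i.
  move=> it it'; apply: contrapT => /eqP d; apply: nex; exists i.
  by rewrite /differ it it' d.
case: (ltngtP (size t) (size t')) => [tt'|tt'|tt'].
- apply/orP; left; apply/orP; right; rewrite tt' /=.
  by apply/forallP=> -[i it]; apply/eqP/eqi => //=; exact: ltn_trans tt'.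
- apply/orP; right; apply/orP; right; rewrite tt' /=.
  by apply/forallP=> -[i it]; apply/eqP/esym/eqi => //=; exact: ltn_trans tt'.
- case/eqP: ne; apply: (eq_from_nth (x0 := 0)) => // a at_.
  have [i it <-] := pos_surj at_.
  by have := eqi i it; rewrite -tt' => /(_ it); rewrite /perm_entry -tt'.
Qed.

Lemma eta_embedding : order_embedding (D_order L A) (Dbar (omega_one_plus A) D) (eta_map A).
Proof.
split; first by move=> t; apply: eta_in.
move=> t t' ht ht'; rewrite [RHS]/=.
have [->|ne] := eqVneq t t'.
  by rewrite (Dbar_refl (None, 0) B_linear) // eta_in.
have [lt|nlt] := boolP (D_lt L A t t'); first by have [] := eta_lt ht ht' lt.
have := D_order_total ht ht' ne; rewrite (negbTE nlt) /= => /(eta_lt ht' ht) [_].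
exact: negbTE.
Qed.

End Order.

(** Naturality holds because the term and the ranks depend only on the length of [t], while its
    entries occur only through [row]. *)
Lemma thread_of_family : thread D L.
Proof.
split; first exact: thread_order_linear.
exists eta_map; split; first exact: eta_embedding.
move=> A B f _ _ _ t _; rewrite /eta_map /Dbar_map /img /= size_map; congr pair.
have sp x : spread (map f t) x = omega_one_plus_map f (spread t x).
  rewrite /spread /place /omega_one_plus_map size_map /=; congr pair.
  have : prio_rank D (size t) (k (size t)) (s (size t)) x <= size t.
    by rewrite -[leqRHS](size_iota 0 (size t)); apply: count_size.
  by case: (prio_rank _ _ _ _ _) => //= a at_; rewrite (nth_map 0).
apply/fsetP=> x; apply/imfsetP/imfsetP => [[i ik ->]|[y /imfsetP [i ik ->] ->]].
  by exists (spread t i); [apply/imfsetP; exists i|rewrite sp].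
by exists i => //; rewrite sp.
Qed.

End Thread.

Theorem theorem3p6 (D : predilator)
  (D_omega2_wf : well_founded_order (Dbar omega_squared D)) :
  RCA0_entails_dilator D \/ exists L : rel nat, thread D L.
Proof.
have [|nD] := pselect (RCA0_entails_dilator D); [by left|right].
have [k [s family]] := exists_linked_family D_omega2_wf nD.
by exists (thread_order D k s); apply: thread_of_family.
Qed.
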